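(* Let $\mathbf{C}$ be a Waldhausen category. Every element of $K_1\mathbf{C}=\ker(\partial\colon\mathcal{D}_1\mathbf{C}\to\mathcal{D}_0\mathbf{C})$ is represented by a pair of weak cofiber sequences; that is, for every $x\in K_1\mathbf{C}$ there is a pair of weak cofiber sequences $\lambda$ in $\mathbf{C}$ such that $x=\{\lambda\}$.
   Context: Groups are written additively even when non-abelian, $[x,y]=-x-y+x+y$ is the commutator and $K^{\mathrm{ab}}$ the abelianization of a group $K$. A stable quadratic module $C_*$ is a diagram of group homomorphisms $C_0^{\mathrm{ab}}\otimes C_0^{\mathrm{ab}}\xrightarrow{\langle\cdot,\cdot\rangle}C_1\xrightarrow{\partial}C_0$ such that for all $c_i,d_i\in C_i$, $i=0,1$: (1) $\partial\langle c_0,d_0\rangle=[d_0,c_0]$; (2) $\langle\partial c_1,\partial d_1\rangle=[d_1,c_1]$; (3) $\langle c_0,d_0\rangle+\langle d_0,c_0\rangle=0$. Morphisms are pairs of group homomorphisms compatible with $\partial$ and $\langle\cdot,\cdot\rangle$. There is a right action of $C_0$ on $C_1$ given by $c_1^{c_0}=c_1+\langle c_0,\partial(c_1)\rangle$. Stable quadratic modules presented by generators and relations in degrees $0$ and $1$ are defined by the obvious universal property. A Waldhausen category $\mathbf{C}$ is a category with distinguished zero object $*$, cofibrations $\rightarrowtail$ and weak equivalences $\xrightarrow{\sim}$ satisfying Waldhausen's axioms. A cofiber sequence $A\rightarrowtail B\twoheadrightarrow B/A$ consists of a cofibration $A\rightarrowtail B$ and a map $B\twoheadrightarrow B/A$ exhibiting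 $B/A$ as the pushout of $*\leftarrow A\rightarrowtail B$. $\mathcal{D}_*\mathbf{C}$ is the stable quadratic module generated in dimension $0$ by symbols $[A]$ for objects $A$, and in dimension $1$ by symbols $[A\xrightarrow{\sim}A']$ for weak equivalences and $[A\rightarrowtail B\twoheadrightarrow B/A]$ for cofiber sequences, subject to: (R1) $\partial[A\xrightarrow{\sim}A']=-[A']+[A]$. (R2) $\partial[A\rightarrowtail B\twoheadrightarrow B/A]=-[B]+[B/A]+[A]$. (R3) $[*]=0$. (R4) $[A\xrightarrow{1_A}A]=0$ (identity as a weak equivalence). (R5) $[A\xrightarrow{1_A}A\twoheadrightarrow *]=0$ and $[*\rightarrowtail A\xrightarrow{1_A}A]=0$. (R6) $[A\xrightarrow{\sim}C]=[B\xrightarrow{\sim}C]+[A\xrightarrow{\sim}B]$ for composable weak equivalences $A\xrightarrow{\sim}B\xrightarrow{\sim}C$ and their composite. (R7) For any commutative diagram given by weak equivalences $A\xrightarrow{\sim}A'$, $B\xrightarrow{\sim}B'$, $B/A\xrightarrow{\sim}B'/A'$ from a cofiber sequence $A\rightarrowtail B\twoheadrightarrow B/A$ to a cofiber sequence $A'\rightarrowtail B'\twoheadrightarrow B'/A'$: $[A\xrightarrow{\sim}A']+[B/A\xrightarrow{\sim}B'/A']^{[A]}=-[A'\rightarrowtail B'\twoheadrightarrow B'/A']+[B\xrightarrow{\sim}B']+[A\rightarrowtail B\twoheadrightarrow B/A]$. (R8) For any commutative diagram of four cofiber sequences $A\rightarrowtail B\twoheadrightarrow B/A$, $A\rightarrowtail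 C\twoheadrightarrow C/A$, $B\rightarrowtail C\twoheadrightarrow C/B$, $B/A\rightarrowtail C/A\twoheadrightarrow C/B$ coming from cofibrations $A\rightarrowtail B\rightarrowtail C$: $[B\rightarrowtail C\twoheadrightarrow C/B]+[A\rightarrowtail B\twoheadrightarrow B/A]=[A\rightarrowtail C\twoheadrightarrow C/A]+[B/A\rightarrowtail C/A\twoheadrightarrow C/B]^{[A]}$. (R9) For any objects $A,B$: $\langle[A],[B]\rangle=-[B\xrightarrow{i_2}A\vee B\xrightarrow{p_1}A]+[A\xrightarrow{i_1}A\vee B\xrightarrow{p_2}B]$, where $i_1,i_2,p_1,p_2$ are the inclusions and projections of a coproduct $A\vee B$ in $\mathbf{C}$. $K_1\mathbf{C}$ denotes Waldhausen's $K_1$, which is identified with $\ker(\partial\colon\mathcal{D}_1\mathbf{C}\to\mathcal{D}_0\mathbf{C})$. A weak cofiber sequence is a diagram $A\rightarrowtail B\twoheadrightarrow C_1\xleftarrow{\sim}C$ given by a cofiber sequence followed by a weak equivalence in the opposite direction; it determines $[A\rightarrowtail B\twoheadrightarrow C_1\xleftarrow{\sim}C]=[A\rightarrowtail B\twoheadrightarrow C_1]+[C\xrightarrow{\sim}C_1]^{[A]}\in\mathcal{D}_1\mathbf{C}$. A pair of weak cofiber sequences $\lambda$ consists of two weak cofiber sequences $\lambda_i=(A\xrightarrow{j_i}B\xrightarrow{r_i}C_i\xleftarrow{w_i}C)$, $i=1,2$, with the first, second and fourth objects $A,B,C$ in common. It determines the element $\{\lambda\}=-[\lambda_1]+[\lambda_2]=[\lambda_2]-[\lambda_1]$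 of $\ker\partial=K_1\mathbf{C}$. *)

(* Defs.v *)
From HB Require Import structures.
Set Warnings "-notation-overridden,-redundant-canonical-projection".
From mathcomp Require Import all_boot.
From mathcomp Require Import boolp.
Set Implicit Arguments.
Unset Strict Implicit.
Unset Printing Implicit Defensive.

Declare Scope cat_scope.
Delimit Scope cat_scope with cat.
Local Open Scope group_scope.
Local Open Scope cat_scope.
Local Open Scope quotient_scope.

Record category := Category {
  obj :> Type;
  hom : obj -> obj -> Type;
  idm : forall A, hom A A;
  comp : forall A B D, hom B D -> hom A B -> hom A D;
  comp1m : forall A B (f : hom A B), comp (idm B) f = f;
  compm1 : forall A B (f : hom A B), comp f (idm A) = f;
  compA : forall A B D E (h : hom D E) (g : hom B D) (f : hom A B),
    comp h (comp g f) = comp (comp h g) f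
}.

Arguments idm {c} A.

Notation "A ~> B" := (hom A B) (at level 70, no associativity) : cat_scope.
Notation "g ∘ f" := (comp g f) (at level 40, left associativity) : cat_scope.

Definition iso (K : category) (A B : K) (f : A ~> B) : Prop :=
  exists g : B ~> A, g ∘ f = idm A /\ f ∘ g = idm B.

(* The square  u ∘ f = v ∘ g  is a pushout of the span  B <-f- A -g-> D. *)
Definition pushout (K : category) (A B D P : K)
    (f : A ~> B) (g : A ~> D) (u : B ~> P) (v : D ~> P) : Prop :=
  u ∘ f = v ∘ g /\
  forall (T : K) (x : B ~> T) (y : D ~> T), x ∘ f = y ∘ g ->
    exists! h : P ~> T, h ∘ u = x /\ h ∘ v = y.

Definition coproduct (K : category) (A B S : K)
    (i1 : A ~> S) (i2 : B ~> S) : Prop :=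
  forall (T : K) (x : A ~> T) (y : B ~> T),
    exists! h : S ~> T, h ∘ i1 = x /\ h ∘ i2 = y.

Record waldhausenCategory := WaldhausenCategory {
  wcat :> category;
  zob : wcat;
  from_zob : forall A : wcat, zob ~> A;
  to_zob : forall A : wcat, A ~> zob;
  from_zob_uniq : forall (A : wcat) (f : zob ~> A), f = from_zob A;
  to_zob_uniq : forall (A : wcat) (f : A ~> zob), f = to_zob A;
  cofib : forall A B : wcat, A ~> B -> Prop;
  weq : forall A B : wcat, A ~> B -> Prop;
  cofib_iso : forall (A B : wcat) (f : A ~> B), iso f -> cofib f;
  cofib_comp : forall (A B D : wcat) (g : B ~> D) (f : A ~> B),
    cofib g -> cofib f -> cofib (g ∘ f);
  cofib_from_zob : forall A : wcat, cofib (from_zob A);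
  cofib_pushout : forall (A B D : wcat) (f : A ~> B) (g : A ~> D), cofib f ->
    exists (P : wcat) (u : B ~> P) (v : D ~> P), pushout f g u v /\ cofib v;
  weq_iso : forall (A B : wcat) (f : A ~> B), iso f -> weq f;
  weq_comp : forall (A B D : wcat) (g : B ~> D) (f : A ~> B),
    weq g -> weq f -> weq (g ∘ f);
  weq_gluing : forall (A B D P A' B' D' P' : wcat)
      (f : A ~> B) (g : A ~> D) (u : B ~> P) (v : D ~> P)
      (f' : A' ~> B') (g' : A' ~> D') (u' : B' ~> P') (v' : D' ~> P')
      (a : A ~> A') (b : B ~> B') (d : D ~> D') (h : P ~> P'),
    cofib f -> cofib f' -> pushout f g u v -> pushout f' g' u' v' ->
    weq a -> weq b -> weq d ->
    b ∘ f = f' ∘ a -> d ∘ g = g' ∘ a -> h ∘ u = u' ∘ b -> h ∘ v = v' ∘ d ->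
    weq h
}.

Arguments zob {w}.
Arguments from_zob {w} A.
Arguments to_zob {w} A.

Definition zerom (K : waldhausenCategory) (A B : K) : A ~> B :=
  from_zob B ∘ to_zob A.

Definition cofiber_sequence (K : waldhausenCategory) (A B Q : K)
    (i : A ~> B) (p : B ~> Q) : Prop :=
  cofib i /\ pushout i (to_zob A) p (from_zob Q).

(* The projections of the coproduct are characterized by the last four
   equations, as K is pointed. *)
Record coproduct_diagram (K : waldhausenCategory) (A B S : K)
    (i1 : A ~> S) (i2 : B ~> S) (p1 : S ~> A) (p2 : S ~> B) : Prop :=
  CoproductDiagram {
    cd_coproduct : coproduct i1 i2;
    cd_p1i1 : p1 ∘ i1 = idm A;
    cd_p1i2 : p1 ∘ i2 = zerom B A;
    cd_p2i1 : p2 ∘ i1 = zerom A B;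
    cd_p2i2 : p2 ∘ i2 = idm B
  }.

Section WaldhausenFacts.
Variable K : waldhausenCategory.
Implicit Types A B S T : K.

Lemma to_zob_eq A (f g : A ~> zob) : f = g.
Proof. by rewrite (to_zob_uniq f) (to_zob_uniq g). Qed.

Lemma from_zob_eq A (f g : zob ~> A) : f = g.
Proof. by rewrite (from_zob_uniq f) (from_zob_uniq g). Qed.

Lemma iso_idm A : iso (idm A).
Proof. by exists (idm A); rewrite comp1m. Qed.

Lemma cofiber_sequence_idl A : cofiber_sequence (idm A) (to_zob A).
Proof.
split; first exact/cofib_iso/iso_idm.
split=> [|T x y]; first exact: to_zob_eq.
rewrite compm1 => ->; exists y; split=> [|h [_ <-]].
  by split=> //; rewrite (to_zob_eq (from_zob _) (idm _)) compm1.
by rewrite (to_zob_eq (from_zob _) (idm _)) compm1.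
Qed.

Lemma cofiber_sequence_idr A : cofiber_sequence (from_zob A) (idm A).
Proof.
split; first exact: cofib_from_zob.
split=> [|T x y _]; first exact: from_zob_eq.
exists x; split=> [|h [<- _]]; last by rewrite compm1.
by split; [rewrite compm1 | exact: from_zob_eq].
Qed.

Lemma coproduct_sym A B S (i1 : A ~> S) (i2 : B ~> S) :
  coproduct i1 i2 -> coproduct i2 i1.
Proof.
move=> cS T x y; have [h [[h1 h2] hu]] := cS T y x.
by exists h; split=> // k [k1 k2]; apply: hu.
Qed.

Lemma coproduct_diagram_sym A B S
    (i1 : A ~> S) (i2 : B ~> S) (p1 : S ~> A) (p2 : S ~> B) :
  coproduct_diagram i1 i2 p1 p2 -> coproduct_diagram i2 i1 p2 p1.
Proof. by case=> /coproduct_sym cS *; split. Qed.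

Lemma coproduct_cofib A B S (i1 : A ~> S) (i2 : B ~> S) :
  coproduct i1 i2 -> cofib i1.
Proof.
move=> cS.
have [P [u [v [[_ pP] cv]]]] := cofib_pushout (from_zob A) (cofib_from_zob B).
have [f [[f1 f2] _]] := cS P v u.
have [g [[g1 g2] _]] := pP S i2 i1 (from_zob_eq _ _).
suff fi : iso g by rewrite -g2; apply: cofib_comp => //; apply: cofib_iso.
exists f; split.
  have [k [_ ku]] := pP P u v (from_zob_eq _ _).
  rewrite -(ku (idm P)) ?comp1m //; apply/esym/ku.
  by rewrite -!compA g1 g2.
have [k [_ ku]] := cS S i1 i2.
rewrite -(ku (idm S)) ?comp1m //; apply/esym/ku.
by rewrite -!compA f1 f2.
Qed.

Lemma coproduct_diagram_exists A B :
  exists (S : K) (i1 : A ~> S) (i2 : B ~> S) (p1 : S ~> A) (p2 : S ~> B),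
    coproduct_diagram i1 i2 p1 p2.
Proof.
have [P [u [v [[_ pP] cv]]]] := cofib_pushout (from_zob B) (cofib_from_zob A).
have cP : coproduct u v by move=> T x y; apply: pP; exact: from_zob_eq.
have [p1 [[p11 p12] _]] := cP A (idm A) (zerom B A).
have [p2 [[p21 p22] _]] := cP B (zerom A B) (idm B).
by exists P, u, v, p1, p2.
Qed.

Lemma coproduct_cofiber_sequence A B S
    (i1 : A ~> S) (i2 : B ~> S) (p1 : S ~> A) (p2 : S ~> B) :
  coproduct_diagram i1 i2 p1 p2 -> cofiber_sequence i1 p2.
Proof.
case=> cS _ _ e1 e2; split; first exact: coproduct_cofib cS.
split=> [|T x y e]; first by rewrite e1.
exists (x ∘ i2); split=> [|h [<- _]]; last by rewrite -compA e2 compm1.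
split; last exact: from_zob_eq.
have [k [_ ku]] := cS T (x ∘ i1) (x ∘ i2).
transitivity k; last exact: ku.
apply/esym/ku; rewrite -!compA e1 e2 compm1; split=> //.
by rewrite e /zerom !compA; congr (_ ∘ _); exact: from_zob_eq.
Qed.

End WaldhausenFacts.

(* Groups, abelian or not, are written multiplicatively: the additive
   [x, y] = -x - y + x + y is  [~ x, y] = x^-1 * (y^-1 * (x * y)).

   A homomorphism from the tensor square of the abelianization of C_0 to C_1
   is given as the corresponding map C_0 x C_0 -> C_1, which is a homomorphism
   in each variable; see sqm_br_commg and sqm_br_commute below. *)
Record stableQuadraticModule := StableQuadraticModule {
  sqm0 : groupType;
  sqm1 : groupType;
  sqm_bd : UMagmaMorphism.type sqm1 sqm0;
  sqm_br : sqm0 -> sqm0 -> sqm1;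
  sqm_brMl : forall c c' d, sqm_br (c * c') d = sqm_br c d * sqm_br c' d;
  sqm_brMr : forall c d d', sqm_br c (d * d') = sqm_br c d * sqm_br c d';
  sqm_bd_br : forall c d, sqm_bd (sqm_br c d) = [~ d, c];
  sqm_br_bd : forall c d, sqm_br (sqm_bd c) (sqm_bd d) = [~ d, c];
  sqm_br_anti : forall c d, sqm_br c d * sqm_br d c = 1
}.

Arguments sqm_bd {s}.

Definition sqm_act (M : stableQuadraticModule) (c1 : sqm1 M) (c0 : sqm0 M) :
  sqm1 M := c1 * sqm_br c0 (sqm_bd c1).

Record sqmMorphism (M N : stableQuadraticModule) := SqmMorphism {
  sqm_map0 : UMagmaMorphism.type (sqm0 M) (sqm0 N);
  sqm_map1 : UMagmaMorphism.type (sqm1 M) (sqm1 N);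
  sqm_map_bd : forall c, sqm_map0 (sqm_bd c) = sqm_bd (sqm_map1 c);
  sqm_map_br : forall c d,
    sqm_map1 (sqm_br c d) = sqm_br (sqm_map0 c) (sqm_map0 d)
}.

Section SqmFacts.
Variable M : stableQuadraticModule.

Lemma sqm_br1l (d : sqm0 M) : sqm_br 1 d = 1.
Proof. by apply: (mulgI (sqm_br 1 d)); rewrite -sqm_brMl !mulg1. Qed.

Lemma sqm_br1r (c : sqm0 M) : sqm_br c 1 = 1.
Proof. by apply: (mulgI (sqm_br c 1)); rewrite -sqm_brMr !mulg1. Qed.

Lemma sqm_brVl (c d : sqm0 M) : sqm_br c^-1 d = (sqm_br c d)^-1.
Proof. by apply: (mulgI (sqm_br c d)); rewrite -sqm_brMl !mulgV sqm_br1l. Qed.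

Lemma sqm_br_commute (c d c' d' : sqm0 M) :
  commute (sqm_br c d) (sqm_br c' d').
Proof.
have : sqm_br (c' * c) (d * d') = sqm_br (c' * c) (d * d') by [].
rewrite {1}sqm_brMl sqm_brMr sqm_brMr [in RHS]sqm_brMr 2!sqm_brMl.
by rewrite -!mulgA => /mulgI; rewrite !mulgA => /mulIg.
Qed.

Lemma sqm_br_commg (c d e : sqm0 M) : sqm_br [~ c, d] e = 1.
Proof.
rewrite /commg /conjg !sqm_brMl !sqm_brVl (sqm_br_commute c e d e).
by rewrite mulKg mulVg.
Qed.

Lemma sqm_ker_central (x y : sqm1 M) : sqm_bd x = 1 -> commute x y.
Proof.
by move=> x1; apply/commgP; rewrite -sqm_br_bd x1 sqm_br1r.
Qed.

End SqmFacts.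

Record dGenerators (K : waldhausenCategory) (M : stableQuadraticModule) :=
  DGenerators {
    dob : K -> sqm0 M;
    dweq : forall (A B : K) (f : A ~> B), weq f -> sqm1 M;
    dcof : forall (A B Q : K) (i : A ~> B) (p : B ~> Q),
      cofiber_sequence i p -> sqm1 M
  }.

Record dRelations (K : waldhausenCategory) (M : stableQuadraticModule)
    (g : dGenerators K M) : Prop := DRelations {
  dR1 : forall (A A' : K) (f : A ~> A') (wf : weq f),
    sqm_bd (dweq g wf) = (dob g A')^-1 * dob g A;
  dR2 : forall (A B Q : K) (i : A ~> B) (p : B ~> Q)
      (s : cofiber_sequence i p),
    sqm_bd (dcof g s) = (dob g B)^-1 * dob g Q * dob g A;
  dR3 : dob g zob = 1;
  dR4 : forall (A : K) (w : weq (idm A)), dweq g w = 1;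
  dR5l : forall (A : K) (s : cofiber_sequence (idm A) (to_zob A)),
    dcof g s = 1;
  dR5r : forall (A : K) (s : cofiber_sequence (from_zob A) (idm A)),
    dcof g s = 1;
  dR6 : forall (A B D : K) (f : A ~> B) (h : B ~> D)
      (wf : weq f) (wh : weq h) (whf : weq (h ∘ f)),
    dweq g whf = dweq g wh * dweq g wf;
  dR7 : forall (A B Q A' B' Q' : K)
      (i : A ~> B) (p : B ~> Q) (i' : A' ~> B') (p' : B' ~> Q')
      (a : A ~> A') (b : B ~> B') (q : Q ~> Q')
      (s : cofiber_sequence i p) (s' : cofiber_sequence i' p')
      (wa : weq a) (wb : weq b) (wq : weq q),
    b ∘ i = i' ∘ a -> q ∘ p = p' ∘ b ->
    dweq g wa * sqm_act (dweq g wq) (dob g A)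
      = (dcof g s')^-1 * dweq g wb * dcof g s;
  dR8 : forall (A B D BA DA DB : K) (i : A ~> B) (j : B ~> D)
      (p : B ~> BA) (q : D ~> DA) (r : D ~> DB) (k : BA ~> DA) (t : DA ~> DB)
      (sAB : cofiber_sequence i p) (sAD : cofiber_sequence (j ∘ i) q)
      (sBD : cofiber_sequence j r) (sQ : cofiber_sequence k t),
    k ∘ p = q ∘ j -> t ∘ q = r ->
    dcof g sBD * dcof g sAB = dcof g sAD * sqm_act (dcof g sQ) (dob g A);
  dR9 : forall (A B S : K)
      (i1 : A ~> S) (i2 : B ~> S) (p1 : S ~> A) (p2 : S ~> B)
      (s1 : cofiber_sequence i1 p2) (s2 : cofiber_sequence i2 p1),
    coproduct_diagram i1 i2 p1 p2 ->
    sqm_br (dob g A) (dob g B) = (dcof g s2)^-1 * dcof g s1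
}.

Record dCompatible (K : waldhausenCategory) (M N : stableQuadraticModule)
    (g : dGenerators K M) (g' : dGenerators K N) (phi : sqmMorphism M N) :
  Prop := DCompatible {
    dcomp_ob : forall A : K, sqm_map0 phi (dob g A) = dob g' A;
    dcomp_weq : forall (A B : K) (f : A ~> B) (wf : weq f),
      sqm_map1 phi (dweq g wf) = dweq g' wf;
    dcomp_cof : forall (A B Q : K) (i : A ~> B) (p : B ~> Q)
        (s : cofiber_sequence i p),
      sqm_map1 phi (dcof g s) = dcof g' s
  }.

(* D_* C is determined up to isomorphism by its universal property; it exists
   by dModule_exists below. *)
Record dModule (K : waldhausenCategory) := DModule {
  dsqm :> stableQuadraticModule;
  dgen : dGenerators K dsqm;
  drel : dRelations dgen;
  dmod_ex : forall (N : stableQuadraticModule) (g : dGenerators K N),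
    dRelations g -> exists phi : sqmMorphism dsqm N, dCompatible dgen g phi;
  dmod_uniq : forall (N : stableQuadraticModule) (g : dGenerators K N)
      (phi psi : sqmMorphism dsqm N),
    dCompatible dgen g phi -> dCompatible dgen g psi ->
    sqm_map0 phi =1 sqm_map0 psi /\ sqm_map1 phi =1 sqm_map1 psi
}.

(* D_* C is constructed as the quotient of the terms in the generators by the
   least congruence that contains the laws of a stable quadratic module and
   the relations. *)
Module DFree.
Section DFree.
Variable K : waldhausenCategory.
Implicit Types A B Q : K.

Inductive tm0 : Type :=
| Ob0 of K
| One0
| Mul0 of tm0 & tm0
| Inv0 of tm0.

Inductive tm1 : Type :=
| Weq1 A B (f : A ~> B) of weq f
| Cof1 A B Q (i : A ~> B) (p : B ~> Q) of cofiber_sequence i p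
| One1
| Mul1 of tm1 & tm1
| Inv1 of tm1
| Br1 of tm0 & tm0.

HB.instance Definition _ := gen_eqMixin tm0.
HB.instance Definition _ := gen_choiceMixin tm0.
HB.instance Definition _ := gen_eqMixin tm1.
HB.instance Definition _ := gen_choiceMixin tm1.

Definition com0 c d := Mul0 (Inv0 c) (Mul0 (Inv0 d) (Mul0 c d)).
Definition com1 c d := Mul1 (Inv1 c) (Mul1 (Inv1 d) (Mul1 c d)).

Fixpoint bd (c : tm1) : tm0 :=
  match c with
  | Weq1 A B _ _ => Mul0 (Inv0 (Ob0 B)) (Ob0 A)
  | Cof1 A B Q _ _ _ => Mul0 (Mul0 (Inv0 (Ob0 B)) (Ob0 Q)) (Ob0 A)
  | One1 => One0
  | Mul1 c d => Mul0 (bd c) (bd d)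
  | Inv1 c => Inv0 (bd c)
  | Br1 c d => com0 d c
  end.

Definition act (c1 : tm1) (c0 : tm0) := Mul1 c1 (Br1 c0 (bd c1)).

Inductive eq0 : tm0 -> tm0 -> Prop :=
| Refl0 c : eq0 c c
| Sym0 c d : eq0 c d -> eq0 d c
| Trans0 c d e : eq0 c d -> eq0 d e -> eq0 c e
| CMul0 c c' d d' : eq0 c c' -> eq0 d d' -> eq0 (Mul0 c d) (Mul0 c' d')
| CInv0 c c' : eq0 c c' -> eq0 (Inv0 c) (Inv0 c')
| Assoc0 c d e : eq0 (Mul0 c (Mul0 d e)) (Mul0 (Mul0 c d) e)
| Unitl0 c : eq0 (Mul0 One0 c) c
| Unitr0 c : eq0 (Mul0 c One0) c
| Invl0 c : eq0 (Mul0 (Inv0 c) c) One0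
| Invr0 c : eq0 (Mul0 c (Inv0 c)) One0
| Bd0 c d : eq1 c d -> eq0 (bd c) (bd d)
| R3 : eq0 (Ob0 zob) One0
with eq1 : tm1 -> tm1 -> Prop :=
| Refl1 c : eq1 c c
| Sym1 c d : eq1 c d -> eq1 d c
| Trans1 c d e : eq1 c d -> eq1 d e -> eq1 c e
| CMul1 c c' d d' : eq1 c c' -> eq1 d d' -> eq1 (Mul1 c d) (Mul1 c' d')
| CInv1 c c' : eq1 c c' -> eq1 (Inv1 c) (Inv1 c')
| CBr1 c c' d d' : eq0 c c' -> eq0 d d' -> eq1 (Br1 c d) (Br1 c' d')
| Assoc1 c d e : eq1 (Mul1 c (Mul1 d e)) (Mul1 (Mul1 c d) e)
| Unitl1 c : eq1 (Mul1 One1 c) c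
| Unitr1 c : eq1 (Mul1 c One1) c
| Invl1 c : eq1 (Mul1 (Inv1 c) c) One1
| Invr1 c : eq1 (Mul1 c (Inv1 c)) One1
| BrMl c c' d : eq1 (Br1 (Mul0 c c') d) (Mul1 (Br1 c d) (Br1 c' d))
| BrMr c d d' : eq1 (Br1 c (Mul0 d d')) (Mul1 (Br1 c d) (Br1 c d'))
| BrBd c d : eq1 (Br1 (bd c) (bd d)) (com1 d c)
| BrAnti c d : eq1 (Mul1 (Br1 c d) (Br1 d c)) One1
| R4 A (w : weq (idm A)) : eq1 (Weq1 w) One1
| R5l A (s : cofiber_sequence (idm A) (to_zob A)) : eq1 (Cof1 s) One1
| R5r A (s : cofiber_sequence (from_zob A) (idm A)) : eq1 (Cof1 s) One1
| R6 A B D (f : A ~> B) (h : B ~> D)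
    (wf : weq f) (wh : weq h) (whf : weq (h ∘ f)) :
    eq1 (Weq1 whf) (Mul1 (Weq1 wh) (Weq1 wf))
| R7 A B Q A' B' Q' (i : A ~> B) (p : B ~> Q) (i' : A' ~> B') (p' : B' ~> Q')
    (a : A ~> A') (b : B ~> B') (q : Q ~> Q')
    (s : cofiber_sequence i p) (s' : cofiber_sequence i' p')
    (wa : weq a) (wb : weq b) (wq : weq q) :
    b ∘ i = i' ∘ a -> q ∘ p = p' ∘ b ->
    eq1 (Mul1 (Weq1 wa) (act (Weq1 wq) (Ob0 A)))
        (Mul1 (Mul1 (Inv1 (Cof1 s')) (Weq1 wb)) (Cof1 s))
| R8 A B D BA DA DB (i : A ~> B) (j : B ~> D)
    (p : B ~> BA) (q : D ~> DA) (r : D ~> DB) (k : BA ~> DA) (t : DA ~> DB)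
    (sAB : cofiber_sequence i p) (sAD : cofiber_sequence (j ∘ i) q)
    (sBD : cofiber_sequence j r) (sQ : cofiber_sequence k t) :
    k ∘ p = q ∘ j -> t ∘ q = r ->
    eq1 (Mul1 (Cof1 sBD) (Cof1 sAB)) (Mul1 (Cof1 sAD) (act (Cof1 sQ) (Ob0 A)))
| R9 A B S (i1 : A ~> S) (i2 : B ~> S) (p1 : S ~> A) (p2 : S ~> B)
    (s1 : cofiber_sequence i1 p2) (s2 : cofiber_sequence i2 p1) :
    coproduct_diagram i1 i2 p1 p2 ->
    eq1 (Br1 (Ob0 A) (Ob0 B)) (Mul1 (Inv1 (Cof1 s2)) (Cof1 s1)).

Scheme eq0_mut := Minimality for eq0 Sort Prop
  with eq1_mut := Minimality for eq1 Sort Prop.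
Combined Scheme eq01_ind from eq0_mut, eq1_mut.

Definition eqb0 : rel tm0 := fun c d => `[< eq0 c d >].
Definition eqb1 : rel tm1 := fun c d => `[< eq1 c d >].

Lemma eqb0_equiv : equiv_class_of eqb0.
Proof.
split=> [c|c d|d c e]; first exact/asboolP/Refl0.
  by apply/asboolP/asboolP; exact: Sym0.
by move=> /asboolP cd /asboolP de; exact/asboolP/(Trans0 cd de).
Qed.

Lemma eqb1_equiv : equiv_class_of eqb1.
Proof.
split=> [c|c d|d c e]; first exact/asboolP/Refl1.
  by apply/asboolP/asboolP; exact: Sym1.
by move=> /asboolP cd /asboolP de; exact/asboolP/(Trans1 cd de).
Qed.

Canonical eqr0 := EquivRelPack eqb0_equiv.
Canonical eqr1 := EquivRelPack eqb1_equiv.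

Definition G0 : Type := {eq_quot eqr0}.
Definition G1 : Type := {eq_quot eqr1}.
HB.instance Definition _ := Choice.on G0.
HB.instance Definition _ := Choice.on G1.

Definition cl0 (c : tm0) : G0 := \pi_({eq_quot eqr0}) c.
Definition cl1 (c : tm1) : G1 := \pi_({eq_quot eqr1}) c.
Definition rp0 (x : G0) : tm0 := repr (x : {eq_quot eqr0}).
Definition rp1 (x : G1) : tm1 := repr (x : {eq_quot eqr1}).

Lemma rp0K : cancel rp0 cl0. Proof. exact: reprK. Qed.
Lemma rp1K : cancel rp1 cl1. Proof. exact: reprK. Qed.

Lemma cl0P c d : cl0 c = cl0 d <-> eq0 c d.
Proof.
by rewrite /cl0; split=> [/eqmodP/asboolP | cd]; last exact/eqmodP/asboolP.
Qed.

Lemma cl1P c d : cl1 c = cl1 d <-> eq1 c d.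
Proof.
by rewrite /cl1; split=> [/eqmodP/asboolP | cd]; last exact/eqmodP/asboolP.
Qed.

Lemma rpcl0 c : eq0 (rp0 (cl0 c)) c. Proof. by apply/cl0P; rewrite rp0K. Qed.
Lemma rpcl1 c : eq1 (rp1 (cl1 c)) c. Proof. by apply/cl1P; rewrite rp1K. Qed.

Lemma cl0_ind (P : G0 -> Prop) : (forall c, P (cl0 c)) -> forall x, P x.
Proof. by move=> Pc x; rewrite -(rp0K x). Qed.

Lemma cl1_ind (P : G1 -> Prop) : (forall c, P (cl1 c)) -> forall x, P x.
Proof. by move=> Pc x; rewrite -(rp1K x). Qed.

Definition mul0 x y := cl0 (Mul0 (rp0 x) (rp0 y)).
Definition inv0 x := cl0 (Inv0 (rp0 x)).
Definition mul1 x y := cl1 (Mul1 (rp1 x) (rp1 y)).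
Definition inv1 x := cl1 (Inv1 (rp1 x)).
Definition br1 x y := cl1 (Br1 (rp0 x) (rp0 y)).
Definition bd1 x := cl0 (bd (rp1 x)).

Lemma mul0E c d : mul0 (cl0 c) (cl0 d) = cl0 (Mul0 c d).
Proof. by apply/cl0P/CMul0; exact: rpcl0. Qed.
Lemma inv0E c : inv0 (cl0 c) = cl0 (Inv0 c).
Proof. by apply/cl0P/CInv0; exact: rpcl0. Qed.
Lemma mul1E c d : mul1 (cl1 c) (cl1 d) = cl1 (Mul1 c d).
Proof. by apply/cl1P/CMul1; exact: rpcl1. Qed.
Lemma inv1E c : inv1 (cl1 c) = cl1 (Inv1 c).
Proof. by apply/cl1P/CInv1; exact: rpcl1. Qed.
Lemma br1E c d : br1 (cl0 c) (cl0 d) = cl1 (Br1 c d).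
Proof. by apply/cl1P/CBr1; exact: rpcl0. Qed.
Lemma bd1E c : bd1 (cl1 c) = cl0 (bd c).
Proof. by apply/cl0P/Bd0; exact: rpcl1. Qed.

Lemma mulA0 : associative mul0.
Proof.
elim/cl0_ind=> c; elim/cl0_ind=> d; elim/cl0_ind=> e.
by rewrite !mul0E; exact/cl0P/Assoc0.
Qed.
Lemma mul10 : left_id (cl0 One0) mul0.
Proof. by elim/cl0_ind=> c; rewrite mul0E; exact/cl0P/Unitl0. Qed.
Lemma mul01 : right_id (cl0 One0) mul0.
Proof. by elim/cl0_ind=> c; rewrite mul0E; exact/cl0P/Unitr0. Qed.
Lemma mulV0 : left_inverse (cl0 One0) inv0 mul0.
Proof. by elim/cl0_ind=> c; rewrite inv0E mul0E; exact/cl0P/Invl0. Qed.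
Lemma mul0V : right_inverse (cl0 One0) inv0 mul0.
Proof. by elim/cl0_ind=> c; rewrite inv0E mul0E; exact/cl0P/Invr0. Qed.

Lemma mulA1 : associative mul1.
Proof.
elim/cl1_ind=> c; elim/cl1_ind=> d; elim/cl1_ind=> e.
by rewrite !mul1E; exact/cl1P/Assoc1.
Qed.
Lemma mul11 : left_id (cl1 One1) mul1.
Proof. by elim/cl1_ind=> c; rewrite mul1E; exact/cl1P/Unitl1. Qed.
Lemma mul1_1 : right_id (cl1 One1) mul1.
Proof. by elim/cl1_ind=> c; rewrite mul1E; exact/cl1P/Unitr1. Qed.
Lemma mulV1 : left_inverse (cl1 One1) inv1 mul1.
Proof. by elim/cl1_ind=> c; rewrite inv1E mul1E; exact/cl1P/Invl1. Qed.
Lemma mul1V : right_inverse (cl1 One1) inv1 mul1.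
Proof. by elim/cl1_ind=> c; rewrite inv1E mul1E; exact/cl1P/Invr1. Qed.

HB.instance Definition _ := isGroup.Build G0 mulA0 mul10 mul01 mulV0 mul0V.
HB.instance Definition _ := isGroup.Build G1 mulA1 mul11 mul1_1 mulV1 mul1V.

Lemma clM0 c d : cl0 c * cl0 d = cl0 (Mul0 c d). Proof. exact: mul0E. Qed.
Lemma clV0 c : (cl0 c)^-1 = cl0 (Inv0 c). Proof. exact: inv0E. Qed.
Lemma clM1 c d : cl1 c * cl1 d = cl1 (Mul1 c d). Proof. exact: mul1E. Qed.
Lemma clV1 c : (cl1 c)^-1 = cl1 (Inv1 c). Proof. exact: inv1E. Qed.

Lemma bd11 : bd1 1 = 1. Proof. exact: bd1E. Qed.
Lemma bd1M : {morph bd1 : x y / x * y}.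
Proof.
by elim/cl1_ind=> c; elim/cl1_ind=> d; rewrite clM1 !bd1E clM0.
Qed.

HB.instance Definition _ := isUMagmaMorphism.Build G1 G0 bd1 (bd11, bd1M).

Lemma com0E c d : [~ cl0 c, cl0 d] = cl0 (com0 c d).
Proof. by rewrite /commg /conjg !clV0 (clM0 c) (clM0 (Inv0 d)) clM0. Qed.
Lemma com1E c d : [~ cl1 c, cl1 d] = cl1 (com1 c d).
Proof. by rewrite /commg /conjg !clV1 (clM1 c) (clM1 (Inv1 d)) clM1. Qed.

Lemma br1Ml c c' d : br1 (c * c') d = br1 c d * br1 c' d.
Proof.
elim/cl0_ind: c => c; elim/cl0_ind: c' => c'; elim/cl0_ind: d => d.
by rewrite clM0 !br1E clM1; exact/cl1P/BrMl.
Qed.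

Lemma br1Mr c d d' : br1 c (d * d') = br1 c d * br1 c d'.
Proof.
elim/cl0_ind: c => c; elim/cl0_ind: d => d; elim/cl0_ind: d' => d'.
by rewrite clM0 !br1E clM1; exact/cl1P/BrMr.
Qed.

Lemma bd1_br1 c d : bd1 (br1 c d) = [~ d, c].
Proof.
by elim/cl0_ind: c => c; elim/cl0_ind: d => d; rewrite br1E bd1E com0E.
Qed.

Lemma br1_bd1 c d : br1 (bd1 c) (bd1 d) = [~ d, c].
Proof.
elim/cl1_ind: c => c; elim/cl1_ind: d => d.
by rewrite !bd1E br1E com1E; exact/cl1P/BrBd.
Qed.

Lemma br1_anti c d : br1 c d * br1 d c = 1.
Proof.
elim/cl0_ind: c => c; elim/cl0_ind: d => d.
by rewrite !br1E clM1; exact/cl1P/BrAnti.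
Qed.

Definition sqm : stableQuadraticModule :=
  @StableQuadraticModule G0 G1 bd1 br1 br1Ml br1Mr bd1_br1 br1_bd1 br1_anti.

Definition gen : dGenerators K sqm :=
  @DGenerators K sqm (fun A => cl0 (Ob0 A)) (fun A B f w => cl1 (Weq1 w))
    (fun A B Q i p s => cl1 (Cof1 s)).

Lemma actE c d : @sqm_act sqm (cl1 c) (cl0 d) = cl1 (act c d).
Proof. by rewrite /sqm_act /= bd1E br1E clM1. Qed.

Lemma gen_rel : dRelations gen.
Proof.
split=> /=.
- by move=> *; rewrite bd1E clV0 clM0.
- by move=> A B Q i p s; rewrite bd1E clV0 (clM0 _ (Ob0 Q)) clM0.
- exact/cl0P/R3.
- by move=> *; exact/cl1P/R4.
- by move=> *; exact/cl1P/R5l.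
- by move=> *; exact/cl1P/R5r.
- by move=> *; rewrite clM1; exact/cl1P/R6.
- move=> A B Q A' B' Q' i p i' p' a b q s s' wa wb wq e1 e2.
  rewrite actE clV1 (clM1 (Weq1 wa)) (clM1 _ (Weq1 wb)) clM1.
  exact/cl1P/R7.
- move=> A B D BA DA DB i j p q r k t sAB sAD sBD sQ e1 e2.
  by rewrite actE (clM1 (Cof1 sBD)) (clM1 (Cof1 sAD)); apply/cl1P; apply: R8.
- by move=> *; rewrite br1E clV1 clM1; apply/cl1P; apply: R9.
Qed.

Section Universal.
Variables (N : stableQuadraticModule) (g : dGenerators K N).
Hypothesis rg : dRelations g.

Fixpoint ev0 (c : tm0) : sqm0 N :=
  match c with
  | Ob0 A => dob g A
  | One0 => 1
  | Mul0 c d => ev0 c * ev0 d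
  | Inv0 c => (ev0 c)^-1
  end.

Fixpoint ev1 (c : tm1) : sqm1 N :=
  match c with
  | Weq1 _ _ _ w => dweq g w
  | Cof1 _ _ _ _ _ s => dcof g s
  | One1 => 1
  | Mul1 c d => ev1 c * ev1 d
  | Inv1 c => (ev1 c)^-1
  | Br1 c d => sqm_br (ev0 c) (ev0 d)
  end.

Lemma ev_bd c : ev0 (bd c) = sqm_bd (ev1 c).
Proof.
elim: c => [A B f w|A B Q i p s||c IHc d IHd|c IHc|c d] /=.
- by rewrite (dR1 rg).
- by rewrite (dR2 rg).
- by rewrite gmulf1.
- by rewrite gmulfM IHc IHd.
- by rewrite gmulfV IHc.
- by rewrite sqm_bd_br.
Qed.

Lemma ev_eq : (forall c d, eq0 c d -> ev0 c = ev0 d) /\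
              (forall c d, eq1 c d -> ev1 c = ev1 d).
Proof.
apply: eq01_ind => //=; rewrite /sqm_act.
all: try by move=> *; congruence.
- by move=> *; rewrite mulgA.
- by move=> *; rewrite mul1g.
- by move=> *; rewrite mulg1.
- by move=> *; rewrite mulVg.
- by move=> *; rewrite mulgV.
- by move=> c d _ cd; rewrite !ev_bd cd.
- exact: dR3 rg.
- by move=> *; rewrite mulgA.
- by move=> *; rewrite mul1g.
- by move=> *; rewrite mulg1.
- by move=> *; rewrite mulVg.
- by move=> *; rewrite mulgV.
- by move=> *; rewrite sqm_brMl.
- by move=> *; rewrite sqm_brMr.
- by move=> *; rewrite !ev_bd sqm_br_bd.
- by move=> *; rewrite sqm_br_anti.
- by move=> *; rewrite (dR4 rg).
- by move=> *; rewrite (dR5l rg).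
- by move=> *; rewrite (dR5r rg).
- by move=> *; apply: dR6 rg _ _ _ _ _ _ _ _.
- move=> A B Q A' B' Q' i p i' p' a b q s s' wa wb wq e1 e2.
  by rewrite -(dR7 rg s s' wa wb wq e1 e2) /sqm_act (dR1 rg).
- move=> A B D BA DA DB i j p q r k t sAB sAD sBD sQ e1 e2.
  by rewrite (dR8 rg sAB sAD sBD sQ e1 e2) /sqm_act (dR2 rg).
- by move=> A B S i1 i2 p1 p2 s1 s2 cd; rewrite (dR9 rg s1 s2 cd).
Qed.

Definition map0 (x : G0) : sqm0 N := ev0 (rp0 x).
Definition map1 (x : G1) : sqm1 N := ev1 (rp1 x).

Lemma map0E c : map0 (cl0 c) = ev0 c.
Proof. exact: (proj1 ev_eq) (rpcl0 c). Qed.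
Lemma map1E c : map1 (cl1 c) = ev1 c.
Proof. exact: (proj2 ev_eq) (rpcl1 c). Qed.

Lemma map01 : map0 1 = 1. Proof. exact: map0E. Qed.
Lemma map0M : {morph map0 : x y / x * y}.
Proof. by elim/cl0_ind=> c; elim/cl0_ind=> d; rewrite clM0 !map0E. Qed.
Lemma map11 : map1 1 = 1. Proof. exact: map1E. Qed.
Lemma map1M : {morph map1 : x y / x * y}.
Proof. by elim/cl1_ind=> c; elim/cl1_ind=> d; rewrite clM1 !map1E. Qed.

HB.instance Definition _ :=
  isUMagmaMorphism.Build G0 (sqm0 N) map0 (map01, map0M).
HB.instance Definition _ :=
  isUMagmaMorphism.Build G1 (sqm1 N) map1 (map11, map1M).

Lemma map_bd c : map0 (bd1 c) = sqm_bd (map1 c).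
Proof. by elim/cl1_ind: c => c; rewrite bd1E map0E map1E ev_bd. Qed.

Lemma map_br c d : map1 (br1 c d) = sqm_br (map0 c) (map0 d).
Proof.
by elim/cl0_ind: c => c; elim/cl0_ind: d => d; rewrite br1E map1E !map0E.
Qed.

Definition map : sqmMorphism sqm N :=
  @SqmMorphism sqm N map0 map1 map_bd map_br.

Lemma map_comp : dCompatible gen g map.
Proof. by split=> *; rewrite /= ?map0E ?map1E. Qed.

Lemma map_uniq (phi : sqmMorphism sqm N) : dCompatible gen g phi ->
  (forall c, sqm_map0 phi (cl0 c) = ev0 c) /\
  (forall c, sqm_map1 phi (cl1 c) = ev1 c).
Proof.
case=> pob pweq pcof.
have p0 c : sqm_map0 phi (cl0 c) = ev0 c.
  elim: c => [A||c IHc d IHd|c IHc] /=; first exact: pob.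
  - exact: gmulf1.
  - by rewrite -clM0 gmulfM IHc IHd.
  - by rewrite -clV0 gmulfV IHc.
split=> //; elim=> [A B f w|A B Q i p s||c IHc d IHd|c IHc|c d] /=.
- exact: pweq.
- exact: pcof.
- exact: gmulf1.
- by rewrite -clM1 gmulfM IHc IHd.
- by rewrite -clV1 gmulfV IHc.
- by rewrite -br1E (sqm_map_br phi) !p0.
Qed.

End Universal.

Definition model : dModule K.
Proof.
apply: (DModule gen_rel) => [N g rg|N g phi psi /map_uniq[a b] /map_uniq[c d]].
  by exists (map rg); exact: map_comp.
by split; [elim/cl0_ind=> x; rewrite a c | elim/cl1_ind=> x; rewrite b d].
Defined.

End DFree.
End DFree.

Theorem dModule_exists (K : waldhausenCategory) : inhabited (dModule K).
Proof. by split; exact: DFree.model. Qed.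

Definition K1 (K : waldhausenCategory) (D : dModule K) :=
  {x : sqm1 D | sqm_bd x == 1}.

(* A >-> B ->> wcs_quo <-~- X *)
Record weakCofiberSequence (K : waldhausenCategory) (A B X : K) :=
  WeakCofiberSequence {
    wcs_quo : K;
    wcs_i : A ~> B;
    wcs_p : B ~> wcs_quo;
    wcs_w : X ~> wcs_quo;
    wcs_cof : cofiber_sequence wcs_i wcs_p;
    wcs_weq : weq wcs_w
  }.

Record weakCofiberPair (K : waldhausenCategory) := WeakCofiberPair {
  wcp_A : K;
  wcp_B : K;
  wcp_C : K;
  wcp1 : weakCofiberSequence wcp_A wcp_B wcp_C;
  wcp2 : weakCofiberSequence wcp_A wcp_B wcp_C
}.

Section WeakCofiberClasses.
Variables (K : waldhausenCategory) (D : dModule K).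

Definition wcs_class (A B X : K) (l : weakCofiberSequence A B X) : sqm1 D :=
  dcof (dgen D) (wcs_cof l) *
  sqm_act (dweq (dgen D) (wcs_weq l)) (dob (dgen D) A).

Lemma wcs_class_bd (A B X : K) (l : weakCofiberSequence A B X) :
  sqm_bd (wcs_class l) =
  (dob (dgen D) B)^-1 * dob (dgen D) X * dob (dgen D) A.
Proof.
rewrite /wcs_class /sqm_act 2!gmulfM sqm_bd_br !(dR1 (drel D)) (dR2 (drel D)).
set c := _^-1 * dob _ X.
by rewrite mulVKg /conjg /c !mulgA mulgK mulgK.
Qed.

Definition wcp_elt (l : weakCofiberPair K) : sqm1 D :=
  (wcs_class (wcp1 l))^-1 * wcs_class (wcp2 l).

Lemma wcp_elt_ker (l : weakCofiberPair K) : sqm_bd (wcp_elt l) == 1.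
Proof. by rewrite /wcp_elt gmulfM gmulfV !wcs_class_bd mulVg. Qed.

Lemma wcp_eltE (l : weakCofiberPair K) :
  wcp_elt l = wcs_class (wcp2 l) * (wcs_class (wcp1 l))^-1.
Proof.
have c : commute (wcp_elt l) (wcs_class (wcp1 l)).
  exact/sqm_ker_central/eqP/wcp_elt_ker.
by rewrite -[LHS](mulgK (wcs_class (wcp1 l))) c /wcp_elt mulVKg.
Qed.

Definition wcp_class (l : weakCofiberPair K) : K1 D :=
  exist _ (wcp_elt l) (wcp_elt_ker l).

End WeakCofiberClasses.

(* Main.v *)
From HB Require Import structures.
Set Warnings "-notation-overridden,-ambiguous-paths".
Set Warnings "-redundant-canonical-projection".
From mathcomp Require Import all_boot ssralg ssrint ring boolp.
Require Import Defs.
Set Implicit Arguments.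
Unset Strict Implicit.
Unset Printing Implicit Defensive.
Local Open Scope group_scope.
Local Open Scope cat_scope.
Local Open Scope quotient_scope.

(** For a pair of weak cofiber sequences A >-> B ->> C_i <-~- X, i = 1, 2, the
    element {lambda} lies in the kernel of the boundary map d : D_1 -> D_0.
    Conversely, an element x of the kernel is realized in two stages.

    Modulo brackets.  The subgroup of D_1 generated by the brackets is central
    and contains the commutators, so the quotient [brquot] of D_1 by it is an
    abelian group, and there the action of D_0 disappears.  Every x in D_1 has
    the class  - [l1] + s1 + [l2] - s2,  where l1 and l2 are weak cofiber
    sequences with common first object A and last object X, whose middle
    objects B1 and B2 are coproducts of lists w1 and w2 of objects, s1 and s2
    are the classes of these decompositions, and d x is the sum of w1 minus the
    sum of w2 in the abelianization of D_0 ([presented_all]).  A cofiber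
    sequence A >-> B ->> C has such a form, with B2 = B and B1 = A v C, and
    coproducts of weak cofiber sequences take care of products in D_1
    ([wcs_add]).  If d x = 1, then w1 and w2 have the same entries apart from
    the zero object, because the abelianization of D_0 is free on the nonzero
    objects.  Coproduct decompositions are commutative, associative and unital
    together with their classes ([wcls] is a commutative monoid), so there is
    an isomorphism f : B1 -> B2 with [f] = s2 - s1.  Transporting l2 along f
    ([wcs_twist]) turns (l1, l2) into a pair lambda with x = {lambda} b, where
    b is a product of brackets of objects.

    Brackets.  Now d b = 1, and d b is a product of commutators of generators
    of D_0.  As D_0 is free nilpotent of class 2 on the nonzero objects, these
    commutators cancel in opposite pairs, and so do the brackets, except those
    of the form <[A],[A]>; hence b = <[E],[E]> for a single object E
    ([bracket_prod_diag]).  This is the class of the automorphism of E v E that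
    exchanges the summands ([bracket_diag_weq]).  Adding E v E to the second
    and the last objects of both members of lambda leaves {lambda} unchanged
    ([wcs_stab]), and twisting the second member by that automorphism
    multiplies {lambda} by b.

    Freeness of D_0 is used only through homomorphisms from D_0 to the integral
    Heisenberg group, which come from the universal property of D_*
    ([dob_lift]). *)

(** * Cofiber sequences and coproducts *)

Section Categories.
Variable K : waldhausenCategory.
Implicit Types A B S T : K.

Lemma zerom_comp A B T (g : B ~> T) : g ∘ zerom A B = zerom A T.
Proof. by rewrite /zerom compA; congr (_ ∘ _); exact: from_zob_eq. Qed.

Lemma comp_zerom A B T (f : A ~> B) : zerom B T ∘ f = zerom A T.
Proof. by rewrite /zerom -compA; congr (_ ∘ _); exact: to_zob_eq. Qed.

Lemma iso_comp A B T (f : A ~> B) (g : B ~> T) : iso f -> iso g -> iso (g ∘ f).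
Proof.
move=> [f' [f1 f2]] [g' [g1 g2]]; exists (f' ∘ g'); split.
  by rewrite -compA (compA g') g1 comp1m.
by rewrite -compA (compA f) f2 comp1m.
Qed.

(** Cofibrations are only assumed to be preserved by some choice of pushout;
    any other pushout differs from it by an isomorphism. *)
Lemma pushout_cofib A B T P
    (f : A ~> B) (g : A ~> T) (u : B ~> P) (v : T ~> P) :
  cofib f -> pushout f g u v -> cofib v.
Proof.
move=> cf [e uP].
have [P' [u' [v' [[e' uP'] cv']]]] := cofib_pushout g cf.
have [h [[h1 h2] _]] := uP P' u' v' e'.
have [k [[k1 k2] _]] := uP' P u v e.
suff ki : iso k by rewrite -k2; apply: cofib_comp => //; exact: cofib_iso.
exists h; split.
  have [l [_ lu]] := uP' P' u' v' e'.
  by rewrite -(lu (idm P')) ?comp1m //; apply/esym/lu; rewrite -!compA k1 k2.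
have [l [_ lu]] := uP P u v e.
by rewrite -(lu (idm P)) ?comp1m //; apply/esym/lu; rewrite -!compA h1 h2.
Qed.

Lemma cofiber_sequence_intro A B T (i : A ~> B) (p : B ~> T) :
  cofib i -> p ∘ i = zerom A T ->
  (forall X (x : B ~> X), x ∘ i = zerom A X -> exists! h : T ~> X, h ∘ p = x) ->
  cofiber_sequence i p.
Proof.
move=> ci e u; split=> //; split=> // X x y e'.
have [|h [h1 h2]] := u X x.
  by rewrite e' /zerom; congr (_ ∘ _); exact: from_zob_eq.
exists h; split=> [|k [k1 _]]; last exact: h2.
by split=> //; exact: from_zob_eq.
Qed.

Section CofiberSequence.
Variables (A B T : K) (i : A ~> B) (p : B ~> T).
Hypothesis s : cofiber_sequence i p.

Lemma cofiber_sequence0 : p ∘ i = zerom A T.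
Proof. by case: s => _ [e _]. Qed.

Lemma cofiber_desc X (x : B ~> X) :
  x ∘ i = zerom A X -> exists h : T ~> X, h ∘ p = x.
Proof.
move=> e; case: s => _ [_ u]; have [h [[h1 _] _]] := u X x (from_zob X) e.
by exists h.
Qed.

Lemma cofiber_ext X (h k : T ~> X) : h ∘ p = k ∘ p -> h = k.
Proof.
move=> e; case: s => _ [_ u].
have [|l [_ lu]] := u X (k ∘ p) (from_zob X).
  by rewrite -compA cofiber_sequence0 zerom_comp.
by transitivity l; [apply/esym/lu | apply/lu]; split=> //; exact: from_zob_eq.
Qed.

End CofiberSequence.

Lemma cofiber_sequence_iso A B B' T (i : A ~> B) (p : B ~> T)
    (f : B ~> B') (f' : B' ~> B) :
  cofiber_sequence i p -> f' ∘ f = idm B -> f ∘ f' = idm B' ->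
  cofiber_sequence (f ∘ i) (p ∘ f').
Proof.
move=> s e e'; apply: cofiber_sequence_intro.
- apply: cofib_comp; last by case: s.
  by apply: cofib_iso; exists f'.
- by rewrite -compA (compA f') e comp1m (cofiber_sequence0 s).
- move=> X x; rewrite compA => /(cofiber_desc s)[h h1]; exists h; split.
    by rewrite compA h1 -compA e' compm1.
  move=> k k1; apply: (cofiber_ext s).
  by rewrite h1 -k1 -!compA e compm1.
Qed.

Section Coproduct.
Variables (A B S : K) (i1 : A ~> S) (i2 : B ~> S).
Hypothesis cS : coproduct i1 i2.

Lemma copair X (x : A ~> X) (y : B ~> X) :
  exists h : S ~> X, h ∘ i1 = x /\ h ∘ i2 = y.
Proof. by have [h [? _]] := cS x y; exists h. Qed.

Lemma coproduct_ext X (h k : S ~> X) :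
  h ∘ i1 = k ∘ i1 -> h ∘ i2 = k ∘ i2 -> h = k.
Proof.
move=> e1 e2; have [l [_ lu]] := cS (k ∘ i1) (k ∘ i2).
by transitivity l; [apply/esym/lu | apply/lu].
Qed.

End Coproduct.

Lemma coproduct_diagram_intro A B S (i1 : A ~> S) (i2 : B ~> S) :
  coproduct i1 i2 -> exists p1 p2, coproduct_diagram i1 i2 p1 p2.
Proof.
move=> cS; have [p1 [p11 p12]] := copair cS (idm A) (zerom B A).
have [p2 [p21 p22]] := copair cS (zerom A B) (idm B).
by exists p1, p2; split.
Qed.

Section CoproductMap.
Variables (A B S A' B' S' : K).
Variables (i1 : A ~> S) (i2 : B ~> S) (p1 : S ~> A) (p2 : S ~> B).
Variables (i1' : A' ~> S') (i2' : B' ~> S') (p1' : S' ~> A') (p2' : S' ~> B').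
Hypothesis cd : coproduct_diagram i1 i2 p1 p2.
Hypothesis cd' : coproduct_diagram i1' i2' p1' p2'.
Variables (f : A ~> A') (g : B ~> B') (h : S ~> S').
Hypotheses (h1 : h ∘ i1 = i1' ∘ f) (h2 : h ∘ i2 = i2' ∘ g).

Lemma coproduct_map_p2 : g ∘ p2 = p2' ∘ h.
Proof.
apply: (coproduct_ext (cd_coproduct cd)).
  rewrite -!compA h1 (cd_p2i1 cd) compA (cd_p2i1 cd') zerom_comp //.
  by rewrite comp_zerom.
by rewrite -!compA h2 (cd_p2i2 cd) compA (cd_p2i2 cd') comp1m compm1.
Qed.

(** Coproducts are pushouts under the zero object, so that the gluing axiom
    applies. *)
Lemma coproduct_map_weq : weq f -> weq g -> weq h.
Proof.
move=> wf wg.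
apply: (@weq_gluing K zob A B S zob A' B' S' (from_zob A) (from_zob B) i1 i2
  (from_zob A') (from_zob B') i1' i2' (idm zob) f g h) => //.
- exact: cofib_from_zob.
- exact: cofib_from_zob.
- by split=> [|T x y _]; [exact: from_zob_eq | exact: (cd_coproduct cd)].
- by split=> [|T x y _]; [exact: from_zob_eq | exact: (cd_coproduct cd')].
- exact/weq_iso/iso_idm.
- exact: from_zob_eq.
- exact: from_zob_eq.
Qed.

Lemma coproduct_map_iso : iso f -> iso g -> iso h.
Proof.
move=> [f' [f1 f2]] [g' [g1 g2]].
have [h' [h1' h2']] := copair (cd_coproduct cd') (i1 ∘ f') (i2 ∘ g').
exists h'; split.
  apply: (coproduct_ext (cd_coproduct cd));
    rewrite -compA ?h1 ?h2 compA ?h1' ?h2'.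
    by rewrite -compA f1 comp1m compm1.
  by rewrite -compA g1 comp1m compm1.
apply: (coproduct_ext (cd_coproduct cd'));
  rewrite -compA ?h1' ?h2' compA ?h1 ?h2.
  by rewrite -compA f2 comp1m compm1.
by rewrite -compA g2 comp1m compm1.
Qed.

End CoproductMap.

End Categories.

Section CoproductCofiber.
Variable K : waldhausenCategory.
Implicit Types A B C S T : K.

(** The quotient of A >-> B v T is C v T.  This adds T to the second and third
    objects of a cofiber sequence and leaves the first one unchanged. *)
Lemma cofiber_sequence_stab A B C T S U (i : A ~> B) (p : B ~> C)
    (b1 : B ~> S) (b2 : T ~> S) (c1 : C ~> U) (c2 : T ~> U) (h : S ~> U) :
  cofiber_sequence i p -> coproduct b1 b2 -> coproduct c1 c2 ->
  h ∘ b1 = c1 ∘ p -> h ∘ b2 = c2 -> cofiber_sequence (b1 ∘ i) h.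
Proof.
move=> s cB cC h1 h2; apply: cofiber_sequence_intro.
- by apply: cofib_comp; [exact: coproduct_cofib cB | case: s].
- by rewrite compA h1 -compA (cofiber_sequence0 s) zerom_comp.
move=> X x; rewrite compA => /(cofiber_desc s)[y ey].
have [k [k1 k2]] := copair cC y (x ∘ b2).
exists k; split.
  by apply: (coproduct_ext cB); rewrite -compA ?h1 ?h2 // compA k1.
move=> l el; apply: (coproduct_ext cC).
  by apply: (cofiber_ext s); rewrite k1 ey -el -!compA h1.
by rewrite k2 -el -compA h2.
Qed.

(** A v T >-> B v T is the cobase change of A >-> B along A >-> A v T, so it has
    the same quotient C. *)
Lemma cofiber_sequence_addl A B C T S U (i : A ~> B) (p : B ~> C)
    (a1 : A ~> S) (a2 : T ~> S) (b1 : B ~> U) (b2 : T ~> U)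
    (q1 : U ~> B) (q2 : U ~> T) (h : S ~> U) :
  cofiber_sequence i p -> coproduct a1 a2 -> coproduct_diagram b1 b2 q1 q2 ->
  h ∘ a1 = b1 ∘ i -> h ∘ a2 = b2 -> cofiber_sequence h (p ∘ q1).
Proof.
move=> s cA cdB h1 h2; have cB := cd_coproduct cdB.
apply: cofiber_sequence_intro.
- apply: (@pushout_cofib K A B S U i a1 b1 h); first by case: s.
  split=> // X x y e; have [k [k1 k2]] := copair cB x (y ∘ a2).
  exists k; split=> [|l [l1 l2]]; last first.
    by apply: (coproduct_ext cB); rewrite ?k1 ?k2 // -h2 compA l2.
  split=> //; apply: (coproduct_ext cA).
    by rewrite -compA h1 compA k1.
  by rewrite -compA h2.
- apply: (coproduct_ext cA); rewrite comp_zerom -!compA ?h1 ?h2.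
    by rewrite (compA q1) (cd_p1i1 cdB) comp1m (cofiber_sequence0 s).
  by rewrite (cd_p1i2 cdB) zerom_comp.
move=> X x e.
have [|y ey] := @cofiber_desc K A B C i p s X (x ∘ b1).
  by rewrite -compA -h1 compA e comp_zerom.
exists y; split.
  apply: (coproduct_ext cB); rewrite -!compA ?(cd_p1i1 cdB) ?(cd_p1i2 cdB).
    by rewrite compm1.
  by rewrite !zerom_comp -h2 compA e comp_zerom.
move=> l el; apply: (cofiber_ext s); rewrite ey -el -!compA.
by rewrite (cd_p1i1 cdB) compm1.
Qed.

Lemma coproduct_assoc A B C S T U (a : A ~> S) (b : B ~> S) (s : S ~> T)
    (c : C ~> T) (b' : B ~> U) (c' : C ~> U) (u : U ~> T) :
  coproduct a b -> coproduct s c -> coproduct b' c' ->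
  u ∘ b' = s ∘ b -> u ∘ c' = c -> coproduct (s ∘ a) u.
Proof.
move=> cS cT cU ub uc X x y.
have [k [k1 k2]] := copair cS x (y ∘ b').
have [h [h1 h2]] := copair cT k (y ∘ c').
exists h; split=> [|l [l1 l2]].
  split; first by rewrite compA h1 k1.
  apply: (coproduct_ext cU); rewrite -compA ?ub ?uc //.
  by rewrite compA h1 k2.
apply: (coproduct_ext cT); rewrite ?h1 ?h2; last by rewrite -uc compA l2.
apply: (coproduct_ext cS); rewrite -compA ?k1 ?l1 ?k2 //.
by rewrite -ub compA l2.
Qed.

Lemma cofiber_sequence_add A B C A' B' C' SA V SB SC
    (i : A ~> B) (p : B ~> C) (i' : A' ~> B') (p' : B' ~> C')
    (a1 : A ~> SA) (a2 : A' ~> SA) (v1 : B ~> V) (v2 : A' ~> V)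
    (b1 : B ~> SB) (b2 : B' ~> SB) (c1 : C ~> SC) (c2 : C' ~> SC)
    (k : SA ~> V) (j : V ~> SB) (h : SB ~> SC) :
  cofiber_sequence i p -> cofiber_sequence i' p' ->
  coproduct a1 a2 -> coproduct v1 v2 -> coproduct b1 b2 -> coproduct c1 c2 ->
  cofib k -> cofib j ->
  k ∘ a1 = v1 ∘ i -> k ∘ a2 = v2 -> j ∘ v1 = b1 -> j ∘ v2 = b2 ∘ i' ->
  h ∘ b1 = c1 ∘ p -> h ∘ b2 = c2 ∘ p' -> cofiber_sequence (j ∘ k) h.
Proof.
move=> s s' cA cV cB cC ck cj k1 k2 j1 j2 h1 h2.
have jk1 : (j ∘ k) ∘ a1 = b1 ∘ i by rewrite -compA k1 compA j1.
have jk2 : (j ∘ k) ∘ a2 = b2 ∘ i' by rewrite -compA k2 j2.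
apply: cofiber_sequence_intro; first exact: cofib_comp.
- apply: (coproduct_ext cA); rewrite -(compA h) ?jk1 ?jk2 compA ?h1 ?h2 -compA.
    by rewrite (cofiber_sequence0 s) zerom_comp comp_zerom.
  by rewrite (cofiber_sequence0 s') zerom_comp comp_zerom.
move=> X x e.
have [|y ey] := @cofiber_desc K A B C i p s X (x ∘ b1).
  by rewrite -compA -jk1 compA e comp_zerom.
have [|y' ey'] := @cofiber_desc K A' B' C' i' p' s' X (x ∘ b2).
  by rewrite -compA -jk2 compA e comp_zerom.
have [l [l1 l2]] := copair cC y y'.
exists l; split.
  by apply: (coproduct_ext cB); rewrite -compA ?h1 ?h2 compA ?l1 ?l2.
move=> m em; apply: (coproduct_ext cC).
  by apply: (cofiber_ext s); rewrite l1 ey -em -!compA h1.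
by apply: (cofiber_ext s'); rewrite l2 ey' -em -!compA h2.
Qed.

End CoproductCofiber.

(** * Elements of D_* as words in the generators *)

Section Terms.
Variables (K : waldhausenCategory) (D : dModule K).

Definition sqm_id (M : stableQuadraticModule) : sqmMorphism M M :=
  @SqmMorphism M M (idfun : UMagmaMorphism.type _ _)
    (idfun : UMagmaMorphism.type _ _) (fun=> erefl) (fun _ _ => erefl).

Definition sqm_comp (M N P : stableQuadraticModule) (psi : sqmMorphism N P)
  (phi : sqmMorphism M N) : sqmMorphism M P.
Proof.
refine (@SqmMorphism M P
  (sqm_map0 psi \o sqm_map0 phi : UMagmaMorphism.type _ _)
  (sqm_map1 psi \o sqm_map1 phi : UMagmaMorphism.type _ _) _ _).
  by move=> c /=; rewrite (sqm_map_bd phi) (sqm_map_bd psi).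
by move=> c d /=; rewrite (sqm_map_br phi) (sqm_map_br psi).
Defined.

(** The endomorphism of D_* that passes through the term model and evaluates
    back fixes the generators, so it is the identity: each element is the value
    of any term that represents its image. *)
Lemma dModule_terms :
  (forall c : sqm0 D, exists t, c = DFree.ev0 (dgen D) t) /\
  (forall c : sqm1 D, exists t, c = DFree.ev1 (dgen D) t).
Proof.
have [phi [p0 pw pc]] := dmod_ex D (DFree.gen_rel K).
have [q0 qw qc] := DFree.map_comp (drel D).
set psi := DFree.map (drel D) in q0 qw qc.
have [||e0 e1] := @dmod_uniq K D D (dgen D) (sqm_comp psi phi) (sqm_id D).
  split=> *.
  - exact: etrans (congr1 (sqm_map0 psi) (p0 _)) (q0 _).
  - exact: etrans (congr1 (sqm_map1 psi) (pw _ _ _ _)) (qw _ _ _ _).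
  - exact: etrans (congr1 (sqm_map1 psi) (pc _ _ _ _ _ _)) (qc _ _ _ _ _ _).
  by split.
split=> c.
  exists (DFree.rp0 (sqm_map0 phi c)).
  rewrite -[LHS]e0 /= -[X in DFree.map0 _ X]DFree.rp0K.
  by rewrite (DFree.map0E (drel D)).
exists (DFree.rp1 (sqm_map1 phi c)).
rewrite -[LHS]e1 /= -[X in DFree.map1 _ X]DFree.rp1K.
by rewrite (DFree.map1E (drel D)).
Qed.

End Terms.

(** * Homomorphisms from D_0 to groups of nilpotency class 2 *)

Section Nil2.
Variables (K : waldhausenCategory) (D : dModule K) (G : groupType).
Hypothesis cen : forall x y z : G, commute [~ x, y] z.

Lemma nil2_commgMr (x y z : G) : [~ x, y * z] = [~ x, y] * [~ x, z].
Proof.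
have -> : [~ x, y * z] = [~ x, z] * [~ x, y] ^ z.
  by rewrite /commg /conjg !gnorm.
have -> : [~ x, y] ^ z = [~ x, y] by apply/conjg_fixP/commgP/cen.
exact/esym/cen.
Qed.

Lemma nil2_commgMl (x y z : G) : [~ x * y, z] = [~ x, z] * [~ y, z].
Proof. by rewrite -invgR nil2_commgMr invgM !invgR; exact: cen. Qed.

Lemma nil2_anti (x y : G) : [~ y, x] * [~ x, y] = 1.
Proof. by rewrite -invgR mulVg. Qed.

(** With the identity as boundary, the commutator is the only possible bracket;
    it is bilinear exactly because the nilpotency class is 2. *)
Definition nil2_sqm : stableQuadraticModule :=
  @StableQuadraticModule G G (idfun : UMagmaMorphism.type _ _)
    (fun c d => [~ d, c]) (fun c c' d => nil2_commgMr d c c')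
    (fun c d d' => nil2_commgMl d d' c) (fun _ _ => erefl) (fun _ _ => erefl)
    (fun c d => nil2_anti c d).

(** D_0 is the free group of class 2 on the nonzero objects.  Since the boundary
    of [nil2_sqm] is the identity, [dR1] and [dR2] force the values on the
    generators of D_1, and the other relations become identities in [G]. *)
Lemma dob_lift (f : K -> G) : f zob = 1 ->
  exists phi : UMagmaMorphism.type (sqm0 D) G,
    forall A, phi (dob (dgen D) A) = f A.
Proof.
move=> f0.
pose g := @DGenerators K nil2_sqm f (fun A B _ _ => (f B)^-1 * f A)
  (fun A B Q _ _ _ => (f B)^-1 * f Q * f A).
have [|phi [p0 _ _]] := @dmod_ex K D nil2_sqm g; last by exists (sqm_map0 phi).
split=> //=; rewrite /sqm_act /= /commg /conjg; intros; rewrite ?f0 !gnorm //.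
Qed.

End Nil2.

(** The integral Heisenberg group: the triple (a, b, c) stands for the upper
    unitriangular matrix with a and b above the diagonal and c in the corner. *)
Definition heis : Type := (int * int * int)%type.
HB.instance Definition _ := Choice.on heis.

Section Heisenberg.
Import GRing.Theory.
Local Open Scope ring_scope.

Definition heis_mul (x y : heis) : heis :=
  (x.1.1 + y.1.1, x.1.2 + y.1.2, x.2 + y.2 + x.1.1 * y.1.2).
Definition heis_one : heis := (0, 0, 0).
Definition heis_inv (x : heis) : heis :=
  (- x.1.1, - x.1.2, - x.2 + x.1.1 * x.1.2).

Lemma heis_mulA : associative heis_mul.
Proof.
by case=> [[a b] c] [[a' b'] c'] [[a'' b''] c'']; congr (_, _, _) => /=; ring.
Qed.
Lemma heis_mul1 : left_id heis_one heis_mul.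
Proof. by case=> [[a b] c]; congr (_, _, _) => /=; ring. Qed.
Lemma heis_1mul : right_id heis_one heis_mul.
Proof. by case=> [[a b] c]; congr (_, _, _) => /=; ring. Qed.
Lemma heis_mulV : left_inverse heis_one heis_inv heis_mul.
Proof. by case=> [[a b] c]; congr (_, _, _) => /=; ring. Qed.
Lemma heis_Vmul : right_inverse heis_one heis_inv heis_mul.
Proof. by case=> [[a b] c]; congr (_, _, _) => /=; ring. Qed.

End Heisenberg.

HB.instance Definition _ :=
  isGroup.Build heis heis_mulA heis_mul1 heis_1mul heis_mulV heis_Vmul.

Section HeisenbergTheory.
Import GRing.Theory.
Local Open Scope ring_scope.

Lemma heisM (x y : heis) : (x * y)%g =
  (x.1.1 + y.1.1, x.1.2 + y.1.2, x.2 + y.2 + x.1.1 * y.1.2).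
Proof. by []. Qed.
Lemma heisV (x : heis) :
  x^-1%g = (- x.1.1, - x.1.2, - x.2 + x.1.1 * x.1.2) :> heis.
Proof. by []. Qed.
Lemma heisR (x y : heis) : [~ x, y]%g = (0, 0, x.1.1 * y.1.2 - y.1.1 * x.1.2).
Proof.
by rewrite /commg /conjg !heisV !heisM /=; congr (_, _, _); ring.
Qed.
Lemma heis_central (x y z : heis) : commute [~ x, y]%g z.
Proof. by rewrite /commute !heisM heisR /=; congr (_, _, _); ring. Qed.

End HeisenbergTheory.

(** * The quotient of D_1 by the brackets *)

Section Brackets.
Variables (K : waldhausenCategory) (D : dModule K).
Local Notation ob := (dob (dgen D)).

Lemma sqm_br_antiV (M : stableQuadraticModule) (c d : sqm0 M) :
  (sqm_br c d)^-1 = sqm_br d c.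
Proof. by apply: (mulgI (sqm_br c d)); rewrite mulgV sqm_br_anti. Qed.

(** A commutator [~ x, y] of D_1 is the bracket of the boundaries of y and x,
    and a bracket vanishes on commutators such as the boundary of a bracket. *)
Lemma sqm_br_central (M : stableQuadraticModule) (c d : sqm0 M) (x : sqm1 M) :
  commute (sqm_br c d) x.
Proof.
apply/commgP; rewrite -sqm_br_bd sqm_bd_br -[sqm_br _ _]invgK sqm_br_antiV.
by rewrite sqm_br_commg invg1.
Qed.

(** By antisymmetry, inverses of brackets are brackets with the arguments
    exchanged, so products without inverses suffice. *)
Definition bracket_prod (l : seq (K * K)) : sqm1 D :=
  \prod_(p <- l) sqm_br (ob p.1) (ob p.2).

Lemma bracket_prod_cat l l' :
  bracket_prod (l ++ l') = bracket_prod l * bracket_prod l'.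
Proof. exact: big_cat. Qed.

Lemma bracket_prod_central l x : commute (bracket_prod l) x.
Proof.
elim: l => [|p l IH]; rewrite /bracket_prod.
  by rewrite big_nil; exact/commute_sym/commute1.
rewrite big_cons; apply/commute_sym/commuteM; apply/commute_sym => //.
exact: sqm_br_central.
Qed.

Lemma bracket_prodV l :
  (bracket_prod l)^-1 = bracket_prod [seq (p.2, p.1) | p <- l].
Proof.
elim: l => [|p l IH]; first by rewrite /bracket_prod !big_nil invg1.
rewrite -cat1s map_cat !bracket_prod_cat invgM IH bracket_prod_central.
by congr (_ * _); rewrite /bracket_prod !big_seq1 /= sqm_br_antiV.
Qed.

Lemma bracket_prod_br (c d : sqm0 D) : exists l, sqm_br c d = bracket_prod l.
Proof.
have [+ _] := dModule_terms D => t0.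
have [{}c ->] := t0 c; have [{}d ->] := t0 d.
elim: c => [A||c [l IH] c' [l' IH']|c [l IH]] /=; last 3 first.
- by exists [::]; rewrite sqm_br1l /bracket_prod big_nil.
- by exists (l ++ l'); rewrite sqm_brMl bracket_prod_cat IH IH'.
- by exists [seq (p.2, p.1) | p <- l]; rewrite sqm_brVl IH bracket_prodV.
elim: d => [B||c [l IH] c' [l' IH']|c [l IH]] /=.
- by exists [:: (A, B)]; rewrite /bracket_prod big_seq1.
- by exists [::]; rewrite sqm_br1r /bracket_prod big_nil.
- by exists (l ++ l'); rewrite sqm_brMr bracket_prod_cat IH IH'.
- exists [seq (p.2, p.1) | p <- l].
  by rewrite -sqm_br_antiV sqm_brVl sqm_br_antiV IH bracket_prodV.
Qed.

End Brackets.

Section Quotient.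
Variables (K : waldhausenCategory) (D : dModule K).

Definition eqbr : rel (sqm1 D) :=
  fun x y => `[< exists l, x = y * bracket_prod D l >].

Lemma eqbrP x y : reflect (exists l, x = y * bracket_prod D l) (eqbr x y).
Proof. exact: asboolP. Qed.

Lemma eqbr_equiv : equiv_class_of eqbr.
Proof.
have r : reflexive eqbr.
  by move=> x; apply/eqbrP; exists [::]; rewrite /bracket_prod big_nil mulg1.
have s x y : eqbr x y -> eqbr y x.
  move=> /eqbrP[l ->]; apply/eqbrP; exists [seq (p.2, p.1) | p <- l].
  by rewrite -bracket_prodV mulgK.
split=> // [x y|y x z]; first by apply/idP/idP; exact: s.
move=> /eqbrP[l ->] /eqbrP[l' ->]; apply/eqbrP; exists (l' ++ l).
by rewrite bracket_prod_cat mulgA.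
Qed.

Canonical eqbr_rel := EquivRelPack eqbr_equiv.

Definition brquot : Type := {eq_quot eqbr_rel}.
HB.instance Definition _ := Choice.on brquot.

Definition brpi (x : sqm1 D) : brquot := \pi_({eq_quot eqbr_rel}) x.
Definition brrepr (x : brquot) : sqm1 D := repr (x : {eq_quot eqbr_rel}).

Lemma brreprK : cancel brrepr brpi. Proof. exact: reprK. Qed.

Lemma brpiP x y : brpi x = brpi y <-> exists l, x = y * bracket_prod D l.
Proof.
by rewrite /brpi; split=> [/eqmodP/eqbrP | xy]; last exact/eqmodP/eqbrP.
Qed.

Lemma brpi_ind (P : brquot -> Prop) : (forall x, P (brpi x)) -> forall x, P x.
Proof. by move=> Px x; rewrite -(brreprK x). Qed.

Definition bradd x y := brpi (brrepr x * brrepr y).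
Definition bropp x := brpi (brrepr x)^-1.

Lemma braddE x y : bradd (brpi x) (brpi y) = brpi (x * y).
Proof.
have /brpiP[l e] := brreprK (brpi x); have /brpiP[l' e'] := brreprK (brpi y).
apply/brpiP; exists (l ++ l'); rewrite e e' bracket_prod_cat !mulgA.
by congr (_ * _); rewrite -!mulgA; congr (_ * _); exact: bracket_prod_central.
Qed.

Lemma broppE x : bropp (brpi x) = brpi x^-1.
Proof.
have /brpiP[l e] := brreprK (brpi x).
apply/brpiP; exists [seq (p.2, p.1) | p <- l].
by rewrite e invgM bracket_prodV bracket_prod_central.
Qed.

Lemma braddA : associative bradd.
Proof.
elim/brpi_ind=> x; elim/brpi_ind=> y; elim/brpi_ind=> z.
by rewrite !braddE mulgA.
Qed.
Lemma braddC : commutative bradd.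
Proof.
elim/brpi_ind=> x; elim/brpi_ind=> y; rewrite !braddE; apply/brpiP.
have [l e] := bracket_prod_br (sqm_bd y) (sqm_bd x).
by exists l; rewrite -e sqm_br_bd -commgC.
Qed.
Lemma bradd0 : left_id (brpi 1) bradd.
Proof. by elim/brpi_ind=> x; rewrite braddE mul1g. Qed.
Lemma braddN : left_inverse (brpi 1) bropp bradd.
Proof. by elim/brpi_ind=> x; rewrite broppE braddE mulVg. Qed.

HB.instance Definition _ :=
  GRing.isZmodule.Build brquot braddA braddC bradd0 braddN.

Lemma brpiM x y : brpi (x * y) = (brpi x + brpi y)%R.
Proof. by rewrite -braddE. Qed.
Lemma brpi1 : brpi 1 = 0%R.
Proof. by []. Qed.
Lemma brpiV x : brpi x^-1 = (- brpi x)%R.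
Proof. by rewrite -broppE. Qed.
Lemma brpi_br c d : brpi (sqm_br c d) = 0%R.
Proof.
rewrite -brpi1; apply/brpiP; have [l ->] := bracket_prod_br c d.
by exists l; rewrite mul1g.
Qed.
Lemma brpi_act x c : brpi (sqm_act x c) = brpi x.
Proof. by rewrite brpiM brpi_br GRing.addr0. Qed.

End Quotient.

(** * The defining relations modulo brackets *)

Section Relations.
Variables (K : waldhausenCategory) (D : dModule K).
Implicit Types A B C S T : K.
Import GRing.Theory.
Local Open Scope ring_scope.

Definition weq_cls A B (f : A ~> B) (w : weq f) : brquot D :=
  brpi (dweq (dgen D) w).
Definition cof_cls A B C (i : A ~> B) (p : B ~> C) (s : cofiber_sequence i p) :
  brquot D := brpi (dcof (dgen D) s).
Definition cop_cls A B S (i1 : A ~> S) (i2 : B ~> S) (p1 : S ~> A) (p2 : S ~> B)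
  (cd : coproduct_diagram i1 i2 p1 p2) : brquot D :=
  cof_cls (coproduct_cofiber_sequence cd).

Lemma weq_cls_idm A (w : weq (idm A)) : weq_cls w = 0.
Proof. by rewrite /weq_cls (dR4 (drel D)) brpi1. Qed.

Lemma weq_cls_comp A B C (f : A ~> B) (g : B ~> C) (h : A ~> C)
    (wf : weq f) (wg : weq g) (wh : weq h) :
  h = g ∘ f -> weq_cls wh = weq_cls wg + weq_cls wf.
Proof.
by move=> e; move: wh; rewrite e => wh; rewrite -brpiM -(dR6 (drel D)).
Qed.

Lemma weq_cls_inv A B (f : A ~> B) (g : B ~> A) (wf : weq f) (wg : weq g) :
  g ∘ f = idm A -> weq_cls wg + weq_cls wf = 0.
Proof.
move=> e; rewrite -(weq_cls_idm (weq_iso (iso_idm A))).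
by apply/esym/weq_cls_comp.
Qed.

Lemma cof_cls_map A B C A' B' C'
    (i : A ~> B) (p : B ~> C) (i' : A' ~> B') (p' : B' ~> C')
    (a : A ~> A') (b : B ~> B') (c : C ~> C')
    (s : cofiber_sequence i p) (s' : cofiber_sequence i' p')
    (wa : weq a) (wb : weq b) (wc : weq c) :
  b ∘ i = i' ∘ a -> c ∘ p = p' ∘ b ->
  weq_cls wa + weq_cls wc + cof_cls s' = weq_cls wb + cof_cls s.
Proof.
move=> e1 e2; have /(congr1 (@brpi K D)) := dR7 (drel D) s s' wa wb wc e1 e2.
rewrite brpiM brpi_act !brpiM brpiV => e; rewrite [weq_cls wa + _]e.
by rewrite addrC !addrA subrr add0r.
Qed.

Lemma cof_cls_comp A B C BA CA CB (i : A ~> B) (j : B ~> C) (ji : A ~> C)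
    (p : B ~> BA) (q : C ~> CA) (r : C ~> CB) (k : BA ~> CA) (t : CA ~> CB)
    (sAB : cofiber_sequence i p) (sAC : cofiber_sequence ji q)
    (sBC : cofiber_sequence j r) (sQ : cofiber_sequence k t) :
  ji = j ∘ i -> k ∘ p = q ∘ j -> t ∘ q = r ->
  cof_cls sBC + cof_cls sAB = cof_cls sAC + cof_cls sQ.
Proof.
move=> e; move: sAC; rewrite e => sAC e1 e2.
have := dR8 (drel D) sAB sAC sBC sQ e1 e2.
by move/(congr1 (@brpi K D)); rewrite !brpiM brpi_br addr0.
Qed.

Lemma cop_cls_sym A B S (i1 : A ~> S) (i2 : B ~> S) (p1 : S ~> A) (p2 : S ~> B)
  (cd : coproduct_diagram i1 i2 p1 p2) (cd' : coproduct_diagram i2 i1 p2 p1) :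
  cop_cls cd = cop_cls cd'.
Proof.
have := dR9 (drel D) (coproduct_cofiber_sequence cd)
  (coproduct_cofiber_sequence cd') cd.
move/(congr1 (@brpi K D)); rewrite brpi_br brpiM brpiV => /esym/eqP.
by rewrite addrC subr_eq0 => /eqP.
Qed.

Lemma cop_cls_map A B S A' B' S'
    (i1 : A ~> S) (i2 : B ~> S) (p1 : S ~> A) (p2 : S ~> B)
    (i1' : A' ~> S') (i2' : B' ~> S') (p1' : S' ~> A') (p2' : S' ~> B')
    (cd : coproduct_diagram i1 i2 p1 p2)
    (cd' : coproduct_diagram i1' i2' p1' p2')
    (f : A ~> A') (g : B ~> B') (h : S ~> S')
    (wf : weq f) (wg : weq g) (wh : weq h) :
  h ∘ i1 = i1' ∘ f -> h ∘ i2 = i2' ∘ g ->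
  weq_cls wf + weq_cls wg + cop_cls cd' = weq_cls wh + cop_cls cd.
Proof.
move=> h1 h2; apply: cof_cls_map => //.
exact: (coproduct_map_p2 cd cd' h1 h2).
Qed.

(** This is [dR8] for the summand inclusions A >-> A v B >-> (A v B) v C. *)
Lemma cop_cls_assoc A B C S T U
    (a : A ~> S) (b : B ~> S) (pa : S ~> A) (pb : S ~> B)
    (s : S ~> T) (c : C ~> T) (ps : T ~> S) (pc : T ~> C)
    (b' : B ~> U) (c' : C ~> U) (pb' : U ~> B) (pc' : U ~> C)
    (sa : A ~> T) (u : U ~> T) (psa : T ~> A) (pu : T ~> U)
    (cS : coproduct_diagram a b pa pb) (cT : coproduct_diagram s c ps pc)
    (cU : coproduct_diagram b' c' pb' pc')
    (cT' : coproduct_diagram sa u psa pu) :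
  sa = s ∘ a -> u ∘ b' = s ∘ b -> u ∘ c' = c ->
  cop_cls cT + cop_cls cS = cop_cls cT' + cop_cls cU.
Proof.
move=> esa ub uc; apply: cof_cls_comp => //.
  apply: (coproduct_ext (cd_coproduct cS)); rewrite -!compA.
    by rewrite (cd_p2i1 cS) zerom_comp -esa (cd_p2i1 cT').
  by rewrite (cd_p2i2 cS) compm1 -ub compA (cd_p2i2 cT') comp1m.
apply: (coproduct_ext (cd_coproduct cT')); rewrite -compA.
  by rewrite (cd_p2i1 cT') zerom_comp esa compA (cd_p2i1 cT) comp_zerom.
apply: (coproduct_ext (cd_coproduct cU)); rewrite (cd_p2i2 cT') compm1 -compA.
  by rewrite ub compA (cd_p2i1 cT) comp_zerom (cd_p2i1 cU).
by rewrite uc (cd_p2i2 cT) (cd_p2i2 cU).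
Qed.

(** Compare the cofiber sequence * >-> B ->> B, of class 0, with
    * >-> * v B ->> B, along the inclusion of B. *)
Lemma cop_cls_zob B S
  (i1 : zob ~> S) (i2 : B ~> S) (p1 : S ~> zob) (p2 : S ~> B)
  (cd : coproduct_diagram i1 i2 p1 p2) (w : weq i2) : weq_cls w = cop_cls cd.
Proof.
have := @cof_cls_map zob B B zob S B
  (from_zob B) (idm B) i1 p2 (idm zob) i2 (idm B)
  (cofiber_sequence_idr B) (coproduct_cofiber_sequence cd)
  (weq_iso (iso_idm _)) w (weq_iso (iso_idm _)).
rewrite !weq_cls_idm !add0r /cof_cls (dR5r (drel D)) brpi1 addr0 => <- //.
  exact: from_zob_eq.
by rewrite comp1m (cd_p2i2 cd).
Qed.

Lemma coproduct_zob_iso B S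
    (i1 : zob ~> S) (i2 : B ~> S) (p1 : S ~> zob) (p2 : S ~> B) :
  coproduct_diagram i1 i2 p1 p2 -> iso i2.
Proof.
move=> cd; exists p2; split; first exact: cd_p2i2 cd.
apply: (coproduct_ext (cd_coproduct cd)); first exact: from_zob_eq.
by rewrite -compA (cd_p2i2 cd) compm1 comp1m.
Qed.

End Relations.

(** * The commutative monoid of weighted objects *)

Section WeightedObjects.
Variables (K : waldhausenCategory) (D : dModule K).
Implicit Types A B C S T : K.
Import GRing.Theory.
Local Open Scope ring_scope.

(** A pair (T, s) stands for an object T with a decomposition into a coproduct,
    where s is the total class of the cofiber sequences that build T from the
    summands.  An isomorphism f of objects changes s by the class of f. *)
Definition wobj : Type := (K * brquot D)%type.
HB.instance Definition _ := gen_eqMixin wobj.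
HB.instance Definition _ := gen_choiceMixin wobj.

Definition wiso : rel wobj := fun x y =>
  `[< exists (f : x.1 ~> y.1) (w : weq f), iso f /\ weq_cls D w + x.2 = y.2 >].

Lemma wiso_equiv : equiv_class_of wiso.
Proof.
have r : reflexive wiso.
  move=> x; apply/asboolP; exists (idm _), (weq_iso (iso_idm _)).
  by split; [exact: iso_idm | rewrite weq_cls_idm add0r].
have s x y : wiso x y -> wiso y x.
  move=> /asboolP[f [w [[g [gf fg]] e]]].
  have gi : iso g by exists f.
  apply/asboolP; exists g, (weq_iso gi); split=> //.
  by rewrite -e addrA (weq_cls_inv D w (weq_iso gi) gf) add0r.
split=> // [x y|y x z]; first by apply/idP/idP; exact: s.
move=> /asboolP[f [wf [fi ef]]] /asboolP[g [wg [gi eg]]]; apply/asboolP.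
exists (g ∘ f), (weq_comp wg wf); split; first exact: iso_comp.
by rewrite (weq_cls_comp D wf wg) // -addrA ef.
Qed.

Canonical wiso_rel := EquivRelPack wiso_equiv.
Definition wcls : Type := {eq_quot wiso_rel}.
HB.instance Definition _ := Choice.on wcls.

Definition cls A (s : brquot D) : wcls := \pi_({eq_quot wiso_rel}) (A, s).

Lemma clsP A B s t : cls A s = cls B t <->
  exists (f : A ~> B) (w : weq f), iso f /\ weq_cls D w + s = t.
Proof.
by rewrite /cls; split=> [/eqmodP/asboolP | ?]; last exact/eqmodP/asboolP.
Qed.

Lemma cls_ind (P : wcls -> Prop) : (forall A s, P (cls A s)) -> forall x, P x.
Proof.
move=> Pc x; rewrite -[x](@reprK _ {eq_quot wiso_rel}).
by case: (repr _) => A s; exact: Pc.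
Qed.

(** Coproducts are not chosen, so the sum of two classes is specified by a
    relation; [cls_addE] shows that it has one value. *)
Lemma cls_add_ex (x y : wcls) : exists z : wcls,
  exists A s B t, x = cls A s /\ y = cls B t /\
  exists S (i1 : A ~> S) (i2 : B ~> S) (p1 : S ~> A) (p2 : S ~> B)
    (cd : coproduct_diagram i1 i2 p1 p2), z = cls S (s + t + cop_cls D cd).
Proof.
elim/cls_ind: x => A s; elim/cls_ind: y => B t.
have [S [i1 [i2 [p1 [p2 cd]]]]] := coproduct_diagram_exists A B.
exists (cls S (s + t + cop_cls D cd)), A, s, B, t; do 2 split=> //.
by exists S, i1, i2, p1, p2, cd.
Qed.

Definition cls_add (x y : wcls) : wcls := projT1 (cid (cls_add_ex x y)).

Lemma cls_addE A B S (i1 : A ~> S) (i2 : B ~> S) (p1 : S ~> A) (p2 : S ~> B)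
    (cd : coproduct_diagram i1 i2 p1 p2) s t :
  cls_add (cls A s) (cls B t) = cls S (s + t + cop_cls D cd).
Proof.
rewrite /cls_add.
case: cid => z /= [A' [s' [B' [t' [/clsP e1 [/clsP e2 e3]]]]]].
have [f [wf [fi ef]]] := e1; have [g [wg [gi eg]]] := e2.
have [S' [i1' [i2' [p1' [p2' [cd' ->]]]]]] := e3.
have [h [h1 h2]] := copair (cd_coproduct cd) (i1' ∘ f) (i2' ∘ g).
apply/esym/clsP; exists h, (coproduct_map_weq cd cd' h1 h2 wf wg); split.
  exact: (coproduct_map_iso cd cd' h1 h2 fi gi).
rewrite addrCA -(cop_cls_map D cd cd' wf wg _ h1 h2) -ef -eg.
by rewrite addrA (addrACA _ s) (addrC (s + t)).
Qed.

Lemma cls_addA : associative cls_add.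
Proof.
elim/cls_ind=> A r; elim/cls_ind=> B s; elim/cls_ind=> C t.
have [S [a [b [pa [pb cS]]]]] := coproduct_diagram_exists A B.
have [T [i [c [pi [pc cT]]]]] := coproduct_diagram_exists S C.
have [U [b' [c' [pb' [pc' cU]]]]] := coproduct_diagram_exists B C.
have [u [ub uc]] := copair (cd_coproduct cU) (i ∘ b) c.
have cT0 := coproduct_assoc
  (cd_coproduct cS) (cd_coproduct cT) (cd_coproduct cU) ub uc.
have [psa [pu cT']] := coproduct_diagram_intro cT0.
rewrite (cls_addE cS) (cls_addE cU) (cls_addE cT) (cls_addE cT').
congr (cls T _); have := cop_cls_assoc D cS cT cU cT' erefl ub uc.
rewrite -!addrA => e; do 2 congr (_ + _).
by rewrite [RHS]addrCA (addrC (cop_cls D cU)) -e (addrC (cop_cls D cT)).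
Qed.

Lemma cls_addC : commutative cls_add.
Proof.
elim/cls_ind=> A r; elim/cls_ind=> B s.
have [S [a [b [pa [pb cS]]]]] := coproduct_diagram_exists A B.
have cS' := coproduct_diagram_sym cS.
by rewrite (cls_addE cS) (cls_addE cS') (cop_cls_sym D cS cS') (addrC r).
Qed.

Lemma cls_add0 : left_id (cls zob 0) cls_add.
Proof.
elim/cls_ind=> B s.
have [S [a [b [pa [pb cS]]]]] := coproduct_diagram_exists zob B.
rewrite (cls_addE cS); apply/esym/clsP.
have bi := coproduct_zob_iso cS; exists b, (weq_iso bi); split=> //.
by rewrite (cop_cls_zob D cS) add0r addrC.
Qed.

HB.instance Definition _ :=
  GRing.isNmodule.Build wcls cls_addA cls_addC cls_add0.

Lemma clsD A B S (i1 : A ~> S) (i2 : B ~> S) (p1 : S ~> A) (p2 : S ~> B)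
    (cd : coproduct_diagram i1 i2 p1 p2) s t :
  cls A s + cls B t = cls S (s + t + cop_cls D cd).
Proof. exact: cls_addE. Qed.

Lemma cls0 : cls zob 0 = 0.
Proof. by []. Qed.

(** The class of any coproduct of the entries of [w], however it is bracketed or
    ordered, with the weight that its construction gives. *)
Definition word_cls (w : seq K) : wcls := \sum_(A <- w) cls A 0.

Lemma word_cls_eq (w1 w2 : seq K) :
  (forall X, X <> zob ->
    count (fun A => `[< A = X >]) w1 = count (fun A => `[< A = X >]) w2) ->
  word_cls w1 = word_cls w2.
Proof.
move=> e.
pose nz : pred K := fun A => ~~ `[< A = zob >].
have red w : word_cls w = \sum_(A <- [seq A : {classic K} <- w | nz A]) cls A 0.
  rewrite /word_cls (bigID nz) /= [X in _ + X]big1 ?addr0 ?big_filter //.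
  by move=> A; rewrite negbK => /asboolP ->.
rewrite !red; apply: perm_big; apply/allP => X _ /=.
rewrite !count_filter.
have cE w : count (predI (pred1 X) nz) w =
    if nz X then count (fun A => `[< A = X >]) w else 0%N.
  elim: w => [|A w IH] /=; first by case: ifP.
  rewrite IH; have -> : (A == X) = `[< A = X >] by apply/eqP/asboolP.
  by case: asboolP => [->|]; case: (nz X).
rewrite !cE; case: ifP => // /asboolP zX.
by rewrite e.
Qed.

End WeightedObjects.

(** * Coproducts of weak cofiber sequences *)

Section Sums.
Variables (K : waldhausenCategory) (D : dModule K).
Implicit Types A B C S T : K.
Import GRing.Theory.
Local Open Scope ring_scope.

(** This is [dR8] for T >-> A v T >-> B v T. *)
Lemma cof_cls_addl A B C T SA SB (i : A ~> B) (p : B ~> C)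
    (a1 : A ~> SA) (a2 : T ~> SA) (pa1 : SA ~> A) (pa2 : SA ~> T)
    (b1 : B ~> SB) (b2 : T ~> SB) (pb1 : SB ~> B) (pb2 : SB ~> T) (h : SA ~> SB)
    (s : cofiber_sequence i p) (cA : coproduct_diagram a1 a2 pa1 pa2)
    (cB : coproduct_diagram b1 b2 pb1 pb2) (sh : cofiber_sequence h (p ∘ pb1)) :
  h ∘ a1 = b1 ∘ i -> h ∘ a2 = b2 ->
  cof_cls D sh + cop_cls D cA = cop_cls D cB + cof_cls D s.
Proof.
move=> h1 h2.
have cA' := coproduct_diagram_sym cA; have cB' := coproduct_diagram_sym cB.
rewrite (cop_cls_sym D cA cA') (cop_cls_sym D cB cB').
apply: cof_cls_comp => //.
by apply: (coproduct_map_p2 cA' cB' (f := idm T) _ h1); rewrite h2 compm1.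
Qed.

(** This is [dR8] for A v A' >-> B v A' >-> B v B', both steps of which are
    treated by [cof_cls_addl]. *)
Lemma cof_cls_add A B C A' B' C' SA SB SC
    (i : A ~> B) (p : B ~> C) (i' : A' ~> B') (p' : B' ~> C')
    (a1 : A ~> SA) (a2 : A' ~> SA) (pa1 : SA ~> A) (pa2 : SA ~> A')
    (b1 : B ~> SB) (b2 : B' ~> SB) (pb1 : SB ~> B) (pb2 : SB ~> B')
    (c1 : C ~> SC) (c2 : C' ~> SC) (pc1 : SC ~> C) (pc2 : SC ~> C')
    (s : cofiber_sequence i p) (s' : cofiber_sequence i' p')
    (cA : coproduct_diagram a1 a2 pa1 pa2)
    (cB : coproduct_diagram b1 b2 pb1 pb2)
    (cC : coproduct_diagram c1 c2 pc1 pc2) :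
  exists (f : SA ~> SB) (q : SB ~> SC) (sh : cofiber_sequence f q),
    cof_cls D sh + cop_cls D cA + cop_cls D cC =
    cof_cls D s + cof_cls D s' + cop_cls D cB.
Proof.
have [V [v1 [v2 [pv1 [pv2 cV]]]]] := coproduct_diagram_exists B A'.
have [k [k1 k2]] := copair (cd_coproduct cA) (v1 ∘ i) v2.
have [j [j1 j2]] := copair (cd_coproduct cV) b1 (b2 ∘ i').
have [h [h1 h2]] := copair (cd_coproduct cB) (c1 ∘ p) (c2 ∘ p').
have cV' := coproduct_diagram_sym cV; have cB' := coproduct_diagram_sym cB.
have sk := cofiber_sequence_addl s (cd_coproduct cA) cV k1 k2.
have sj := cofiber_sequence_addl s' (cd_coproduct cV') cB' j2 j1.
have sh : cofiber_sequence (j ∘ k) h.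
  apply: (cofiber_sequence_add s s' (cd_coproduct cA) (cd_coproduct cV)
    (cd_coproduct cB) (cd_coproduct cC) _ _ k1 k2 j1 j2 h1 h2).
    by case: sk.
  by case: sj.
exists (j ∘ k), h, sh.
have ek := cof_cls_addl s cA cV sk k1 k2.
have ej := cof_cls_addl s' cV' cB' sj j2 j1.
rewrite -(cop_cls_sym D cV) -(cop_cls_sym D cB) in ej.
have eh : cof_cls D sj + cof_cls D sk =
    cof_cls D sh + cof_cls D (coproduct_cofiber_sequence cC).
  apply: cof_cls_comp => //; last exact/esym/(coproduct_map_p2 cB cC h1 h2).
  apply: (coproduct_ext (cd_coproduct cV)); rewrite -!compA ?j1 ?j2.
    by rewrite (cd_p1i1 cV) compm1 h1.
  rewrite (cd_p1i2 cV) !zerom_comp compA h2 -compA (cofiber_sequence0 s').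
  by rewrite zerom_comp.
rewrite addrAC -/(cop_cls D cC) -eh -addrA ek.
by rewrite addrA ej addrC (addrC (cop_cls D cB)) addrA.
Qed.

Definition wcs_cls A B X (l : weakCofiberSequence A B X) : brquot D :=
  brpi (wcs_class D l).

Lemma wcs_clsE A B X (l : weakCofiberSequence A B X) :
  wcs_cls l = cof_cls D (wcs_cof l) + weq_cls D (wcs_weq l).
Proof. by rewrite /wcs_cls brpiM brpi_act. Qed.

Lemma wcs_add A B X A' B' X' SA SB SX
    (a1 : A ~> SA) (a2 : A' ~> SA) (pa1 : SA ~> A) (pa2 : SA ~> A')
    (b1 : B ~> SB) (b2 : B' ~> SB) (pb1 : SB ~> B) (pb2 : SB ~> B')
    (x1 : X ~> SX) (x2 : X' ~> SX) (px1 : SX ~> X) (px2 : SX ~> X')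
    (cA : coproduct_diagram a1 a2 pa1 pa2)
    (cB : coproduct_diagram b1 b2 pb1 pb2)
    (cX : coproduct_diagram x1 x2 px1 px2)
    (l : weakCofiberSequence A B X) (l' : weakCofiberSequence A' B' X') :
  exists l2 : weakCofiberSequence SA SB SX,
    wcs_cls l2 + (cop_cls D cA + cop_cls D cX) =
    wcs_cls l + wcs_cls l' + cop_cls D cB.
Proof.
have [SC [c1 [c2 [pc1 [pc2 cC]]]]] :=
  coproduct_diagram_exists (wcs_quo l) (wcs_quo l').
have [f [q [sh esh]]] := cof_cls_add (wcs_cof l) (wcs_cof l') cA cB cC.
have [w [w1 w2]] := copair (cd_coproduct cX) (c1 ∘ wcs_w l) (c2 ∘ wcs_w l').
have ww := coproduct_map_weq cX cC w1 w2 (wcs_weq l) (wcs_weq l').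
exists (WeakCofiberSequence sh ww); rewrite !wcs_clsE /=.
have ew := cop_cls_map D cX cC (wcs_weq l) (wcs_weq l') ww w1 w2.
rewrite addrACA -ew.
rewrite [LHS]addrA [LHS]addrAC esh.
by rewrite addrAC [in RHS]addrACA.
Qed.

End Sums.

(** * Presentations of the elements of D_1 by pairs *)

Section Presentations.
Variables (K : waldhausenCategory) (D : dModule K).
Implicit Types A B C S T : K.
Import GRing.Theory.
Local Open Scope ring_scope.
Local Notation ob := (dob (dgen D)).

Definition additive0 (c : sqm0 D -> int) := forall u v, c (u * v)%g = c u + c v.

Lemma additive01 c : additive0 c -> c 1%g = 0.
Proof. by move=> cM; apply: (addrI (c 1%g)); rewrite -cM mulg1 addr0. Qed.

Lemma additive0V c u : additive0 c -> c u^-1%g = - c u.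
Proof.
by move=> cM; apply: (addrI (c u)); rewrite -cM mulgV additive01 // subrr.
Qed.

(** The last clause records the boundary of x in the abelianization of D_0,
    through the homomorphisms to the integers. *)
Definition presented (x : sqm1 D) : Prop :=
  exists (w1 w2 : seq K) (A X B1 B2 : K)
    (l1 : weakCofiberSequence A B1 X) (l2 : weakCofiberSequence A B2 X)
    (s1 s2 : brquot D),
    [/\ cls B1 s1 = word_cls D w1, cls B2 s2 = word_cls D w2,
        brpi x + wcs_cls D l1 + s2 = wcs_cls D l2 + s1 &
        forall c, additive0 c ->
          c (sqm_bd x) = \sum_(A <- w1) c (ob A) - \sum_(A <- w2) c (ob A)].

Definition wcs_weq_from A X (w : X ~> A) (ww : weq w) :
  weakCofiberSequence zob A X :=
  WeakCofiberSequence (cofiber_sequence_idr A) ww.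

Lemma wcs_cls_weq_from A X (w : X ~> A) (ww : weq w) :
  wcs_cls D (wcs_weq_from ww) = weq_cls D ww.
Proof. by rewrite wcs_clsE /cof_cls (dR5r (drel D)) brpi1 add0r. Qed.

Definition wcs_of_cofiber A B C (i : A ~> B) (p : B ~> C)
  (s : cofiber_sequence i p) : weakCofiberSequence A B C :=
  WeakCofiberSequence s (weq_iso (iso_idm C)).

Lemma wcs_cls_of_cofiber A B C (i : A ~> B) (p : B ~> C)
  (s : cofiber_sequence i p) : wcs_cls D (wcs_of_cofiber s) = cof_cls D s.
Proof. by rewrite wcs_clsE weq_cls_idm addr0. Qed.

Lemma presented_weq A B (f : A ~> B) (w : weq f) : presented (dweq (dgen D) w).
Proof.
exists [:: A], [:: B], zob, A, A, B, (wcs_weq_from (weq_iso (iso_idm A))).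
exists (wcs_weq_from w), 0, 0.
rewrite /word_cls !big_seq1 !wcs_cls_weq_from weq_cls_idm !addr0.
split=> // c cM.
by rewrite !big_seq1 (dR1 (drel D)) cM additive0V // addrC.
Qed.

(** The first member of the pair is the split sequence A >-> A v C ->> C. *)
Lemma presented_cof A B C (i : A ~> B) (p : B ~> C) (s : cofiber_sequence i p) :
  presented (dcof (dgen D) s).
Proof.
have [S [i1 [i2 [p1 [p2 cd]]]]] := coproduct_diagram_exists A C.
exists [:: A; C], [:: B], A, C, S, B.
exists (wcs_of_cofiber (coproduct_cofiber_sequence cd)), (wcs_of_cofiber s).
exists (cop_cls D cd), 0; rewrite /word_cls !big_cons !big_nil !addr0.
rewrite !wcs_cls_of_cofiber (clsD cd) !add0r; split=> // c cM.
rewrite !big_cons !big_nil !addr0 (dR2 (drel D)) !cM additive0V //.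
by rewrite -addrA addrC (addrC (c (ob A))).
Qed.

Lemma presented_br u v : presented (sqm_br u v).
Proof.
exists [::], [::], zob, zob, zob, zob, (wcs_weq_from (weq_iso (iso_idm zob))).
exists (wcs_weq_from (weq_iso (iso_idm zob))), 0, 0.
rewrite /word_cls !big_nil cls0 brpi_br add0r; split=> // c cM.
rewrite !big_nil subrr sqm_bd_br /commg /conjg !cM !additive0V //.
by rewrite (addrC (c v)) addKr addNr.
Qed.

Lemma presented1 : presented 1%g.
Proof. by rewrite -(sqm_br1l (1%g : sqm0 D)); exact: presented_br. Qed.

Lemma presentedV x : presented x -> presented x^-1%g.
Proof.
move=> [w1 [w2 [A [X [B1 [B2 [l1 [l2 [s1 [s2 [e1 e2 e ec]]]]]]]]]]].
exists w2, w1, A, X, B2, B1, l2, l1, s2, s1; split=> //.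
  by rewrite brpiV -addrA -e -addrA addrA addNr add0r.
by move=> c cM; rewrite gmulfV additive0V // ec // opprB.
Qed.

Lemma presentedM x x' : presented x -> presented x' -> presented (x * x')%g.
Proof.
move=> [w1 [w2 [A [X [B1 [B2 [l1 [l2 [s1 [s2 [e1 e2 e ec]]]]]]]]]]].
move=> [w1' [w2' [A' [X' [B1' [B2' [l1' [l2' [s1' [s2' []]]]]]]]]]].
move=> e1' e2' e' ec'.
have [SA [? [? [? [? cA]]]]] := coproduct_diagram_exists A A'.
have [SX [? [? [? [? cX]]]]] := coproduct_diagram_exists X X'.
have [S1 [? [? [? [? c1]]]]] := coproduct_diagram_exists B1 B1'.
have [S2 [? [? [? [? c2]]]]] := coproduct_diagram_exists B2 B2'.
have [m1 em1] := wcs_add D cA c1 cX l1 l1'.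
have [m2 em2] := wcs_add D cA c2 cX l2 l2'.
exists (w1 ++ w1'), (w2 ++ w2'), SA, SX, S1, S2, m1, m2.
exists (s1 + s1' + cop_cls D c1), (s2 + s2' + cop_cls D c2); split.
- by rewrite -clsD e1 e1' /word_cls big_cat.
- by rewrite -clsD e2 e2' /word_cls big_cat.
- (* The classes of the sums of A and of X enter both members equally. *)
  apply: (addIr (cop_cls D cA + cop_cls D cX)).
  rewrite brpiM [LHS]addrAC [RHS]addrAC em2 -(addrA _ (wcs_cls D m1)) em1.
  rewrite (addrA (brpi x + _)) (addrACA (brpi x)) [LHS]addrACA.
  rewrite (addrACA (brpi x + _)) e e' [RHS]addrACA (addrC (cop_cls D c2)).
  by rewrite (addrACA (wcs_cls D l2)).
- move=> c cM; rewrite gmulfM cM ec // ec' // !big_cat /=.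
  by rewrite addrACA -opprD.
Qed.

Lemma presented_all x : presented x.
Proof.
have [_ /(_ x)[t ->]] := dModule_terms D.
elim: t => [A B f w|A B C i p s||t IH t' IH'|t IH|u v] /=.
- exact: presented_weq.
- exact: presented_cof.
- exact: presented1.
- exact: presentedM.
- exact: presentedV.
- exact: presented_br.
Qed.

(** The homomorphism that sends the object X to 1 and the other ones to 0 counts
    the occurrences of X in a word; it exists only for X nonzero, and the zero
    object contributes nothing to [word_cls]. *)
Lemma ker_word_cls (w1 w2 : seq K) :
  (forall c, additive0 c ->
    \sum_(A <- w1) c (ob A) = \sum_(A <- w2) c (ob A)) ->
  word_cls D w1 = word_cls D w2.
Proof.
move=> e; apply: word_cls_eq => X zX.
pose f A : heis := if `[< A = X >] then (1, 0, 0) else (0, 0, 0).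
have [|phi phiE] := dob_lift D heis_central (f := f).
  by rewrite /f; case: asboolP => // /esym.
have cM : additive0 (fun u => (phi u).1.1) by move=> u v; rewrite gmulfM.
have sumE w :
    \sum_(A <- w) (phi (ob A)).1.1 = (count (fun A => `[< A = X >]) w)%:Z.
  elim: w => [|A w IH]; first by rewrite big_nil.
  rewrite big_cons IH phiE /f /=; case: asboolP => _ /=; last by rewrite add0r.
  by rewrite PoszD.
by have := e _ cM; rewrite !sumE => -[].
Qed.

End Presentations.

(** * Modifications of pairs with exact control of the class *)

Section Exact.
Variables (K : waldhausenCategory) (D : dModule K).
Implicit Types A B C S T X : K.
Local Notation ob := (dob (dgen D)).

Lemma sqm_actM (M : stableQuadraticModule) (x y : sqm1 M) c :
  sqm_act (x * y) c = sqm_act x c * sqm_act y c.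
Proof.
rewrite /sqm_act gmulfM sqm_brMr -!mulgA; congr (_ * _).
by rewrite !mulgA; congr (_ * _); apply/esym/sqm_br_central.
Qed.

Lemma sqm_act1 (M : stableQuadraticModule) c : sqm_act (1 : sqm1 M) c = 1.
Proof. by rewrite /sqm_act gmulf1 sqm_br1r mulg1. Qed.

Lemma sqm_actV (M : stableQuadraticModule) (x : sqm1 M) c :
  sqm_act x^-1 c = (sqm_act x c)^-1.
Proof. by apply: (mulgI (sqm_act x c)); rewrite -sqm_actM !mulgV sqm_act1. Qed.

Lemma sqm_act_ker (M : stableQuadraticModule) (x : sqm1 M) c :
  sqm_bd x = 1 -> sqm_act x c = x.
Proof. by move=> x1; rewrite /sqm_act x1 sqm_br1r mulg1. Qed.

(** This is [dR7] for the isomorphism of cofiber sequences (1, f, 1). *)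
Lemma wcs_twist A B B' X (l : weakCofiberSequence A B X)
    (f : B' ~> B) (w : weq f) :
  iso f -> exists l' : weakCofiberSequence A B' X,
    wcs_class D l' = (dweq (dgen D) w)^-1 * wcs_class D l.
Proof.
move=> [f' [f1 f2]]; have s := cofiber_sequence_iso (wcs_cof l) f2 f1.
exists (WeakCofiberSequence s (wcs_weq l)); rewrite /wcs_class /= [RHS]mulgA.
congr (_ * sqm_act _ _).
have := @dR7 _ _ _ (drel D) _ _ _ _ _ _ _ _ _ _
  (idm A) f (idm (wcs_quo l)) s (wcs_cof l)
  (weq_iso (iso_idm _)) w (weq_iso (iso_idm _)).
rewrite !(dR4 (drel D)) sqm_act1 mulg1 compA f2 comp1m compm1 comp1m.
move=> /(_ erefl erefl) e; apply: (mulgI (dweq (dgen D) w)); rewrite mulVKg.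
by apply: (mulgI (dcof (dgen D) (wcs_cof l))^-1); rewrite mulgA -e mulVg.
Qed.

(** The two outer factors depend only on A, B, X and T.  They are therefore the
    same for both members of a pair, and they cancel in its element of the
    kernel. *)
Lemma wcs_stab A B X T SB SX (l : weakCofiberSequence A B X)
    (b1 : B ~> SB) (b2 : T ~> SB) (pb1 : SB ~> B) (pb2 : SB ~> T)
    (x1 : X ~> SX) (x2 : T ~> SX) (px1 : SX ~> X) (px2 : SX ~> T)
    (cB : coproduct_diagram b1 b2 pb1 pb2)
    (cX : coproduct_diagram x1 x2 px1 px2) :
  exists l' : weakCofiberSequence A SB SX,
    wcs_class D l' =
      dcof (dgen D) (coproduct_cofiber_sequence cB) * wcs_class D l *
      (sqm_act (dcof (dgen D) (coproduct_cofiber_sequence cX)) (ob A))^-1.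
Proof.
case: l => C i p w s ww.
have [SC [c1 [c2 [pc1 [pc2 cC]]]]] := coproduct_diagram_exists C T.
have [h [h1 h2]] := copair (cd_coproduct cB) (c1 ∘ p) c2.
have [v [v1 v2]] := copair (cd_coproduct cX) (c1 ∘ w) c2.
have h2' : h ∘ b2 = c2 ∘ idm T by rewrite compm1.
have v2' : v ∘ x2 = c2 ∘ idm T by rewrite compm1.
have s' := cofiber_sequence_stab s (cd_coproduct cB) (cd_coproduct cC) h1 h2.
have wT := weq_iso (iso_idm T).
have wv := coproduct_map_weq cX cC v1 v2' ww wT.
exists (WeakCofiberSequence s' wv); rewrite /wcs_class /=.
have tq : pc2 ∘ h = pb2 by rewrite -(coproduct_map_p2 cB cC h1 h2') comp1m.
have e8 := dR8 (drel D) s s' (coproduct_cofiber_sequence cB)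
  (coproduct_cofiber_sequence cC) (esym h1) tq.
have e7 := dR7 (drel D) (coproduct_cofiber_sequence cX)
  (coproduct_cofiber_sequence cC) ww wv wT v1
  (coproduct_map_p2 cX cC v1 v2').
rewrite (mulgA (dcof _ (coproduct_cofiber_sequence cB))) e8.
rewrite -!(mulgA (dcof _ s')); congr (_ * _).
have -> : dweq (dgen D) wv = dcof (dgen D) (coproduct_cofiber_sequence cC) *
    dweq (dgen D) ww * (dcof (dgen D) (coproduct_cofiber_sequence cX))^-1.
  move: e7; rewrite (dR4 (drel D)) sqm_act1 mulg1 => ->.
  by rewrite -!mulgA mulVKg mulgV mulg1.
by rewrite !sqm_actM sqm_actV !mulgA.
Qed.

(** * Products of brackets in the kernel *)

Lemma bd_bracket_prod (l : seq (K * K)) :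
  sqm_bd (bracket_prod D l) = \prod_(p <- l) [~ ob p.2, ob p.1].
Proof.
elim: l => [|p l IH]; first by rewrite /bracket_prod !big_nil gmulf1.
by rewrite /bracket_prod !big_cons gmulfM sqm_bd_br -IH.
Qed.

Lemma bracket_prod_rem (q : {classic K} * {classic K})
    (l : seq ({classic K} * {classic K})) :
  q \in l ->
  bracket_prod D l = sqm_br (ob q.1) (ob q.2) * bracket_prod D (rem q l).
Proof.
elim: l => //= p l IH; rewrite inE /bracket_prod !big_cons.
case: eqVneq => [->|_] //=.
move=> /IH e; rewrite big_cons.
by rewrite [X in _ * X = _]e !mulgA; congr (_ * _); exact: sqm_br_central.
Qed.

(** Send A and B to the standard generators of the Heisenberg group and all
    other objects to 1.  The commutators of the pairs (A, B) and (B, A) then go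
    to opposite generators of the center, those of all other pairs to 1. *)
Lemma bracket_prod_count (l : seq ({classic K} * {classic K}))
    (A B : {classic K}) :
  sqm_bd (bracket_prod D l) = 1 -> A != B -> A <> zob -> B <> zob ->
  count_mem (A, B) l = count_mem (B, A) l.
Proof.
move=> l1 AB A0 B0.
pose f (C : {classic K}) : heis := ((C == A)%:Z, (C == B)%:Z, 0)%R.
have [|phi phiE] := dob_lift D heis_central (f := f).
  rewrite /f; case: eqVneq => [/esym //|_]; case: eqVneq => [/esym //|_] //.
suff e : phi (sqm_bd (bracket_prod D l)) =
    (0, 0, (count_mem (B, A) l)%:Z - (count_mem (A, B) l)%:Z)%R.
  move: e; rewrite l1 gmulf1 => -[/esym/eqP].
  by rewrite GRing.subr_eq0 => /eqP[].
rewrite bd_bracket_prod.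
elim: l {l1} => [|[C C'] l IH]; first by rewrite big_nil gmulf1.
rewrite big_cons gmulfM IH gmulfR !phiE heisR heisM /f /=.
rewrite !xpair_eqE !PoszD; congr (_, _, _)%R.
have nAB : forall C : {classic K}, ~~ ((C == A) && (C == B)).
  by move=> X; apply/andP => -[/eqP-> /eqP e]; rewrite e eqxx in AB.
by move: (nAB C) (nAB C'); do 4 case: (_ == _) => //=; move=> _ _; ring.
Qed.

Lemma sqm_br_diagM (M : stableQuadraticModule) (c d : sqm0 M) :
  sqm_br (c * d) (c * d) = sqm_br c c * sqm_br d d.
Proof.
rewrite sqm_brMl !sqm_brMr -!mulgA; congr (_ * _).
by rewrite mulgA sqm_br_anti mul1g.
Qed.

(** The map c |-> <c,c> is a homomorphism that kills boundaries, since these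
    give commutators [~ x, x]; so it is additive on cofiber sequences. *)
Lemma sqm_br_diag_cofiber A B C (i : A ~> B) (p : B ~> C) :
  cofiber_sequence i p ->
  sqm_br (ob B) (ob B) = sqm_br (ob C) (ob C) * sqm_br (ob A) (ob A).
Proof.
move=> s; have -> : ob B = ob C * ob A * (sqm_bd (dcof (dgen D) s))^-1.
  by rewrite (dR2 (drel D)) !invgM invgK !mulgA mulgK mulgV mul1g.
by rewrite !sqm_br_diagM -gmulfV sqm_br_bd commgg mulg1.
Qed.

(** Brackets of two distinct nonzero objects cancel with the brackets of the
    exchanged pairs, and a bracket <[A],[A]> is absorbed by the passage from E
    to A v E. *)
Lemma bracket_prod_diag (l : seq ({classic K} * {classic K})) :
  sqm_bd (bracket_prod D l) = 1 ->
  exists E, bracket_prod D l = sqm_br (ob E) (ob E).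
Proof.
have [n] := ubnP (size l); elim: n l => // n IH [|[A B] l] /=.
  move=> _ _; exists zob.
  by rewrite (dR3 (drel D)) sqm_br1l /bracket_prod big_nil.
rewrite ltnS => sl l1.
have e : bracket_prod D ((A, B) :: l) = sqm_br (ob A) (ob B) * bracket_prod D l.
  exact: big_cons.
have red : sqm_br (ob A) (ob B) = 1 ->
    exists E, bracket_prod D ((A, B) :: l) = sqm_br (ob E) (ob E).
  move=> AB1; move: l1; rewrite e AB1 mul1g => l1.
  exact: IH.
have [A0|A0] := eqVneq A zob.
  by apply: red; rewrite A0 (dR3 (drel D)) sqm_br1l.
have [B0|B0] := eqVneq B zob.
  by apply: red; rewrite B0 (dR3 (drel D)) sqm_br1r.
have [AB|AB] := eqVneq A B.
  have [|E eE] := IH l sl.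
    by move: l1; rewrite e gmulfM sqm_bd_br AB commgg mul1g.
  have [S [i1 [i2 [p1 [p2 cd]]]]] := coproduct_diagram_exists A E.
  exists S; rewrite e eE -AB.
  rewrite (sqm_br_diag_cofiber (coproduct_cofiber_sequence cd)).
  exact: sqm_br_central.
(* The head pair occurs, so its opposite occurs in the tail and cancels it. *)
have BAl : (B, A) \in l.
  have := bracket_prod_count l1 AB (elimN eqP A0) (elimN eqP B0).
  rewrite /= eqxx xpair_eqE (negbTE AB) /= add0n => e'.
  by rewrite -has_pred1 has_count -e'.
have e' : bracket_prod D ((A, B) :: l) = bracket_prod D (rem (B, A) l).
  by rewrite e (bracket_prod_rem BAl) mulgA sqm_br_anti mul1g.
rewrite e'; apply: IH; last by rewrite -e'.
by rewrite size_rem //; exact: leq_ltn_trans (leq_pred _) sl.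
Qed.

(** By [dR7] the exchange of summands has the class of the difference of the two
    cofiber sequences of E v E, which [dR9] identifies. *)
Lemma bracket_diag_weq E S (i1 i2 : E ~> S) (p1 p2 : S ~> E)
    (cd : coproduct_diagram i1 i2 p1 p2) (f : S ~> S) (w : weq f) :
  f ∘ i1 = i2 -> f ∘ i2 = i1 -> dweq (dgen D) w = sqm_br (ob E) (ob E).
Proof.
move=> f1 f2; have cd' := coproduct_diagram_sym cd.
have e9 := dR9 (drel D) (coproduct_cofiber_sequence cd)
  (coproduct_cofiber_sequence cd') cd.
have f1' : f ∘ i1 = i2 ∘ idm E by rewrite compm1.
have f2' : f ∘ i2 = i1 ∘ idm E by rewrite compm1.
have := dR7 (drel D)
  (coproduct_cofiber_sequence cd) (coproduct_cofiber_sequence cd')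
  (weq_iso (iso_idm E)) w (weq_iso (iso_idm E)) f1'
  (coproduct_map_p2 cd cd' f1' f2').
rewrite !(dR4 (drel D)) sqm_act1 mulg1.
set c' := dcof _ _ in e9 *; set c := dcof _ _ in e9 * => e7.
have cE : c = c' * sqm_br (ob E) (ob E) by rewrite e9 mulVKg.
have -> : dweq (dgen D) w = c' * c^-1.
  by apply: (mulgI c'^-1); apply: (mulIg c); rewrite -e7 mulKg mulVg.
by rewrite cE invgM sqm_br_antiV (sqm_br_central _ _ c'^-1) mulVKg.
Qed.

(** * Pairs for the elements of the kernel *)

(** The presentation of x, transported along the isomorphism of the middle
    objects that comes with the equality of their words. *)
Lemma ker_pair_mod_brackets (x : sqm1 D) : sqm_bd x = 1 ->
  exists A B X (l1 l2 : weakCofiberSequence A B X) l,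
    x = (wcs_class D l1)^-1 * wcs_class D l2 * bracket_prod D l.
Proof.
move=> x1.
have [w1 [w2 [A [X [B1 [B2 [l1 [l2' [s1 [s2 [e1 e2 e ec]]]]]]]]]]] :=
  presented_all x.
have we : word_cls D w1 = word_cls D w2.
  apply: ker_word_cls => c cM; apply/eqP; rewrite -GRing.subr_eq0 -ec //.
  by rewrite x1 additive01.
have /clsP[f [wf [fi ef]]] : cls B1 s1 = cls B2 s2 by rewrite e1 e2.
have [l2 el2] := wcs_twist l2' wf fi.
exists A, B1, X, l1, l2; apply/brpiP.
rewrite el2 brpiM (brpiM (dweq _ wf)^-1) !brpiV.
apply: (GRing.addIr (wcs_cls D l1 + s2)%R).
rewrite GRing.addrA e -ef /weq_cls /wcs_cls [RHS]GRing.addrACA GRing.addNr.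
by rewrite GRing.add0r (GRing.addrC (- _)%R) GRing.addrA GRing.subrK.
Qed.

(** With T = E v E added to both members of the pair, the automorphism 1 v t of
    B v T, where t exchanges the summands of T, has the class of t. *)
Lemma pair_mul_bracket_diag A B X (l1 l2 : weakCofiberSequence A B X) E :
  exists SB SX (m1 m2 : weakCofiberSequence A SB SX),
    (wcs_class D m1)^-1 * wcs_class D m2 =
    (wcs_class D l1)^-1 * wcs_class D l2 * sqm_br (ob E) (ob E).
Proof.
have [T [i1 [i2 [p1 [p2 cT]]]]] := coproduct_diagram_exists E E.
have [SB [b1 [b2 [pb1 [pb2 cB]]]]] := coproduct_diagram_exists B T.
have [SX [x1 [x2 [px1 [px2 cX]]]]] := coproduct_diagram_exists X T.
have [m1 em1] := wcs_stab l1 cB cX.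
have [m2' em2'] := wcs_stab l2 cB cX.
have [t [t1 t2]] := copair (cd_coproduct cT) i2 i1.
have tt : t ∘ t = idm T.
  by apply: (coproduct_ext (cd_coproduct cT)); rewrite -compA ?t1 ?t2 comp1m.
have ti : iso t by exists t.
have tE := bracket_diag_weq cT (weq_iso ti) t1 t2.
have [h [h1 h2]] := copair (cd_coproduct cB) b1 (b2 ∘ t).
have h1' : h ∘ b1 = b1 ∘ idm B by rewrite compm1.
have hi : iso h := coproduct_map_iso cB cB h1' h2 (iso_idm _) ti.
have hE : dweq (dgen D) (weq_iso hi) = sqm_br (ob E) (ob E).
  have := dR7 (drel D)
    (coproduct_cofiber_sequence cB) (coproduct_cofiber_sequence cB)
    (weq_iso (iso_idm B)) (weq_iso hi) (weq_iso ti) h1'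
    (coproduct_map_p2 cB cB h1' h2).
  rewrite (dR4 (drel D)) mul1g tE sqm_act_ker; last by rewrite sqm_bd_br commgg.
  set c := dcof _ _ => e7; apply: (mulgI c^-1); apply: (mulIg c).
  by rewrite -e7 -mulgA sqm_br_central mulKg.
have [m2 em2] := wcs_twist m2' (weq_iso hi) hi.
exists SB, SX, m1, m2.
rewrite em1 em2 em2' hE sqm_br_antiV.
set c := dcof _ (coproduct_cofiber_sequence cB); set d := sqm_act _ _.
set b := sqm_br _ _; rewrite (invgM (c * _)) (invgM c) invgK.
set y := _^-1 * wcs_class D l2.
have y1 : sqm_bd y = 1 := eqP (wcp_elt_ker D (WeakCofiberPair l1 l2)).
have -> : d * ((wcs_class D l1)^-1 * c^-1) * (b * (c * wcs_class D l2 * d^-1)) =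
    d * (y * b) * d^-1.
  rewrite (sqm_br_central _ _ (c * _ * _)) -/b /y !mulgA mulgVK.
  by rewrite -!mulgA -[in LHS](sqm_br_central _ _ d^-1).
have yb : sqm_bd (y * b) = 1 by rewrite gmulfM y1 mul1g sqm_bd_br commgg.
by rewrite -(sqm_ker_central d yb) mulgK.
Qed.

End Exact.

Theorem theorem2p2 (K : waldhausenCategory) (D : dModule K) (x : K1 D) :
  exists l : weakCofiberPair K, x = wcp_class D l.
Proof.
case: x => x kx; have /eqP x1 := kx.
have [A [B [X [l1 [l2 [l xl]]]]]] := ker_pair_mod_brackets x1.
have [|E lE] := @bracket_prod_diag K D l.
  move: x1; rewrite xl gmulfM.
  by have /eqP -> := wcp_elt_ker D (WeakCofiberPair l1 l2); rewrite mul1g.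
have [SB [SX [m1 [m2 em]]]] := pair_mul_bracket_diag D l1 l2 E.
by exists (WeakCofiberPair m1 m2); apply: val_inj; rewrite /= xl lE -em.
Qed.
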